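(* Let $\mathbb{V}=(\mathscr{E},\pi,\mathscr{B},\mathbb{X},\mathscr{A})$ be a smooth vector bundle over $\Bbbk$ (where $\Bbbk=\mathbb{R}$ or $\Bbbk=\mathbb{C}$), and let $r,s$ be non-negative integers. Then the quintuple $\big(\mathscr{T}_r^s(\mathbb{V}),\ \pi_{\mathbb{V}}^{(r,s)},\ \mathscr{B},\ T_r^s(\mathbb{X}),\ \mathscr{A}^{(r,s)}_{\mathbb{V}}\big)$ is a smooth vector bundle, where $\mathscr{T}_r^s(\mathbb{V})$ is the manifold of all $(r,s)$-tensors on the fibers of $\mathbb{V}$, $\pi_{\mathbb{V}}^{(r,s)}$ is the base-point projection, $T_r^s(\mathbb{X})$ is the vector space of $(r,s)$-tensors on the typical fiber $\mathbb{X}$, and $\mathscr{A}^{(r,s)}_{\mathbb{V}}$ is the maximal vector bundle atlas containing all the maps $\Delta^{(r,s)}_\psi$, $\psi\in\mathscr{A}$ (all defined in the context).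
   Context: Manifolds are $C^\infty$, without boundary, finite-dimensional (of non-zero dimension), Hausdorff and second-countable; smooth means $C^\infty$. $\Bbbk$ is $\mathbb{R}$ or $\mathbb{C}$. A finite-dimensional $\Bbbk$-vector space carries its canonical structure of a real smooth manifold (of real dimension twice the complex dimension if $\Bbbk=\mathbb{C}$). Smooth vector bundle: a quintuple $(\mathscr{E},\pi,\mathscr{B},\mathbb{X},\mathscr{A})$ where $\mathscr{E}$ and $\mathscr{B}$ are manifolds with underlying sets $E$ and $B$, $\pi:\mathscr{E}\to\mathscr{B}$ is smooth, $\mathbb{X}$ is a finite-dimensional $\Bbbk$-vector space, and $\mathscr{A}$ is a collection of local trivializations, i.e. pairs $(U,\psi)$ with $U\subseteq B$ non-empty open and $\psi:\pi^{-1}(U)\to U\times\mathbb{X}$ a diffeomorphism whose first component is $\pi$, such that the sets $U$ cover $B$, such that for all $(U,\phi),(V,\psi)\in\mathscr{A}$ and $p\in U\cap V$ the map $\widetilde\phi_p\circ\widetilde\psi_p^{-1}:\mathbb{X}\to\mathbb{X}$ is a $\Bbbk$-linear isomorphism, and such that $\mathscr{A}$ is maximal with these properties. Here $\widetilde\psi_p:\pi^{-1}(\{p\})\to\mathbb{X}$ is the restriction to the fiber over $p$ of the second component of $\psi$. $\mathrm{Fib}_{\mathbb{V}}(p)$ denotes $\pi^{-1}(\{p\})$ with the unique $\Bbbk$-vector space structure making every $\widetilde\psi_p$ a linear isomorphism. Tensors: for a finite-dimensional $\Bbbk$-vector space $W$, $T_r^s(W)$ is the $\Bbbk$-vector space of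 all $\Bbbk$-multilinear maps $W^r\times (W^* )^s\to\Bbbk$, with $T_0^0(W)=\Bbbk$. For a linear isomorphism $L:W\to W_1$, the $(r,s)$-pullback $L^\star_{(r,s)}:T_r^s(W_1)\to T_r^s(W)$ is $[L^\star_{(r,s)}\beta](v_1,\dots,v_{r+s})=\beta\big(Lv_1,\dots,Lv_r,\,v_{r+1}\circ L^{-1},\dots,v_{r+s}\circ L^{-1}\big)$ if $r+s>0$, and $L^\star_{(0,0)}=\mathrm{Id}_{\Bbbk}$. Tensor bundle data: for $U\subseteq B$, let $\mathcal{T}_r^s(U;\mathbb{V})=\bigcup_{p\in U}T_r^s(\mathrm{Fib}_{\mathbb{V}}(p))$ (regarded as a disjoint union). The projection $\pi^{(r,s)}_{\mathbb{V}}:\mathcal{T}_r^s(B;\mathbb{V})\to B$ sends every $\alpha\in T_r^s(\mathrm{Fib}_{\mathbb{V}}(p))$ to $p$. For a chart $(U,\phi)$ of $\mathscr{B}$ and $(U,\psi)\in\mathscr{A}$ with the same $U$, define $\Xi^{(r,s)}_{(\phi,\psi)}:\mathcal{T}_r^s(U;\mathbb{V})\to\phi(U)\times T_r^s(\mathbb{X})$ by $\alpha\mapsto\big(\phi(p),(\widetilde\psi_p^{-1})^\star_{(r,s)}\alpha\big)$ for $\alpha\in T_r^s(\mathrm{Fib}_{\mathbb{V}}(p))$. $\mathscr{T}_r^s(\mathbb{V})$ denotes $\mathcal{T}_r^s(B;\mathbb{V})$ with the manifold structure whose maximal atlas is generated by all the maps $\Xi^{(r,s)}_{(\phi,\psi)}$.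 For $(U,\psi)\in\mathscr{A}$, define $\Delta^{(r,s)}_\psi:\mathcal{T}_r^s(U;\mathbb{V})\to U\times T_r^s(\mathbb{X})$ by $\alpha\mapsto\big(p,(\widetilde\psi_p^{-1})^\star_{(r,s)}\alpha\big)$ for $\alpha\in T_r^s(\mathrm{Fib}_{\mathbb{V}}(p))$. *)

(* Defs.v *)
From HB Require Import structures.
From mathcomp Require Import all_boot all_order all_algebra complex.
From mathcomp Require Import all_classical all_reals all_analysis.

Set Implicit Arguments.
Unset Strict Implicit.
Unset Printing Implicit Defensive.

Import Order.TTheory GRing.Theory Num.Theory numFieldNormedType.Exports.

Local Open Scope classical_set_scope.
Local Open Scope ring_scope.

(* [f] is C^(k+1) on [O] when it is Fréchet differentiable on [O] and
   [x |-> Df(x)v] is C^k on [O] for every [v]; in finite dimension the latter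
   says that [x |-> Df(x)] is C^k.  Meaningful for [O] open. *)
Fixpoint Ck (R : realType) (V W : normedModType R) (k : nat) (O : set V)
    (f : V -> W) : Prop :=
  match k with
  | 0 => forall x, O x -> {for x, continuous f}
  | k'.+1 => (forall x, O x -> differentiable f x) /\
             (forall v, Ck k' O (fun x => 'd f x v))
  end.

Definition Cinfty (R : realType) (V W : normedModType R) (O : set V)
    (f : V -> W) : Prop := forall k, Ck k O f.

(* A chart of dimension [n]; only the values of [chart_map] on [chart_dom]
   matter. *)
Record chart (R : realType) (M : Type) (n : nat) := Chart {
  chart_dom : set M;
  chart_map : M -> 'rV[R]_n }.

Section Charts.
Variables (R : realType) (M : Type) (n : nat).
Implicit Types (c d : chart R M n) (A G : set (chart R M n)).

Definition chart_image c : set 'rV[R]_n := chart_map c @` chart_dom c.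

Definition is_chart c : Prop :=
  {in chart_dom c &, injective (chart_map c)} /\ open (chart_image c).

Definition chart_overlap c d : set 'rV[R]_n :=
  chart_map c @` (chart_dom c `&` chart_dom d).

(* [F] represents [chart_map d \o (chart_map c)^-1] on the overlap. *)
Definition smooth_transition c d : Prop :=
  open (chart_overlap c d) /\
  exists F : 'rV[R]_n -> 'rV[R]_n,
    Cinfty (chart_overlap c d) F /\
    forall x, chart_dom c x -> chart_dom d x ->
      F (chart_map c x) = chart_map d x.

Definition chart_compatible c d : Prop :=
  smooth_transition c d /\ smooth_transition d c.

Definition is_atlas A : Prop :=
  [/\ forall c, A c -> is_chart c,
      forall x, exists2 c, A c & chart_dom c x
    & forall c d, A c -> A d -> chart_compatible c d].

Definition is_maximal_atlas A : Prop :=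
  is_atlas A /\ forall A', is_atlas A' -> A `<=` A' -> A' = A.

Definition generated_atlas G : set (chart R M n) :=
  [set c | is_chart c /\ forall d, G d -> chart_compatible c d].

End Charts.

Record charted (R : realType) := Charted {
  carrier :> Type;
  mdim : nat;
  atlas : set (chart R carrier mdim) }.
Arguments atlas {R} M _ : rename.

(* The topology of a charted set is generated by the sets
   [phi^-1(O)] with [(U, phi)] a chart and [O] open. *)
Definition chart_open (R : realType) (M : charted R) : set (set M) :=
  [set W | exists2 c, atlas M c &
     exists2 O, open O & W = chart_dom c `&` chart_map c @^-1` O].

HB.instance Definition _ (R : realType) (M : charted R) :=
  gen_eqMixin (carrier M).
HB.instance Definition _ (R : realType) (M : charted R) :=
  gen_choiceMixin (carrier M).
HB.instance Definition _ (R : realType) (M : charted R) :=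
  isSubBaseTopological.Build (carrier M) (@chart_open R M) id.

Definition is_manifold (R : realType) (M : charted R) : Prop :=
  [/\ (0 < mdim M)%N, is_maximal_atlas (atlas M),
      hausdorff_space M & @second_countable M].

Section SmoothMaps.
Variables (R : realType) (M N : charted R).

(* The condition forces [D] to be open in [M]. *)
Definition smooth_on (D : set M) (f : M -> N) : Prop :=
  forall x, D x -> exists c d, [/\ atlas M c, atlas N d & [/\ chart_dom c x,
    chart_dom c `<=` D, f @` chart_dom c `<=` chart_dom d &
    exists F : 'rV[R]_(mdim M) -> 'rV[R]_(mdim N),
      Cinfty (chart_image c) F /\
      forall y, chart_dom c y -> F (chart_map c y) = chart_map d (f y)]].

End SmoothMaps.

Definition diffeomorphism_on (R : realType) (M N : charted R)
    (D : set M) (D' : set N) (f : M -> N) : Prop :=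
  exists g : N -> M,
    [/\ (forall x, D x -> D' (f x)) /\ (forall y, D' y -> D (g y)),
        forall x, D x -> g (f x) = x, forall y, D' y -> f (g y) = y,
        smooth_on D f & smooth_on D' g].

(* The smooth structures are over [R]; the ground field of vector spaces is
   [scalar R k], that is [R] or [R[i]]. *)
Variant ground := RealNumbers | ComplexNumbers.

Definition scalar (R : realType) (k : ground) : fieldType :=
  match k with RealNumbers => R | ComplexNumbers => R[i] end.

Definition of_real (R : realType) (k : ground) : R -> scalar R k :=
  match k with RealNumbers => id | ComplexNumbers => real_complex R end.

Definition real_degree (k : ground) : nat :=
  match k with RealNumbers => 1 | ComplexNumbers => 2 end.

Section RealCoordinates.
Variables (R : realType) (k : ground) (X : vectType (scalar R k)).

Definition real_dim : nat := (real_degree k * dim X)%N.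

Definition real_linear n (f : X -> 'rV[R]_n) : Prop :=
  forall a x y, f (of_real k a *: x + y) = a *: f x + f y.

(* The global charts that define the canonical smooth structure of [X]. *)
Definition real_coordinates : set (X -> 'rV[R]_real_dim) :=
  [set f | real_linear f /\ bijective f].

Definition prod_chart (B : charted R) (c : chart R B (mdim B))
    (f : X -> 'rV[R]_real_dim) : chart R (B * X) (mdim B + real_dim) :=
  Chart (chart_dom c `*` setT) (fun x => row_mx (chart_map c x.1) (f x.2)).

Definition prod_space (B : charted R) : charted R :=
  Charted (generated_atlas
    [set e | exists2 c, atlas B c &
       exists2 f, real_coordinates f & e = prod_chart c f]).

End RealCoordinates.

(* Only the values of [triv_map] over [triv_dom] matter. *)
Record triv (R : realType) (k : ground) (E B : charted R)
    (X : vectType (scalar R k)) := Triv {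
  triv_dom : set B;
  triv_map : E -> prod_space X B }.

Record quintuple (R : realType) (k : ground) := Quintuple {
  total : charted R;
  base : charted R;
  proj : total -> base;
  typical : vectType (scalar R k);
  trivs : set (triv total base typical) }.
Arguments proj {R k} Q _ : rename.
Arguments trivs {R k} Q _ : rename.

Section VectorBundle.
Variables (R : realType) (k : ground).

Section Trivializations.
Variables (E B : charted R) (pi : E -> B) (X : vectType (scalar R k)).
Implicit Types (s t : triv E B X) (A G : set (triv E B X)).

Definition is_local_triv t : Prop :=
  [/\ triv_dom t !=set0, open (triv_dom t),
      forall x, triv_dom t (pi x) -> (triv_map t x).1 = pi x
    & diffeomorphism_on (pi @^-1` triv_dom t)
        (triv_dom t `*` setT : set (prod_space X B)) (triv_map t)].

(* [L] is [s_p \o t_p^-1], where [s_p], [t_p] are the second components of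
   [s], [t] on the fiber over [p]. *)
Definition triv_compatible s t : Prop :=
  forall p, triv_dom s p -> triv_dom t p ->
  exists2 L : 'End(X), bijective L &
    forall x, pi x = p -> L (triv_map t x).2 = (triv_map s x).2.

Definition is_bundle_atlas A : Prop :=
  [/\ forall t, A t -> is_local_triv t,
      forall p, exists2 t, A t & triv_dom t p
    & forall s t, A s -> A t -> triv_compatible s t].

Definition is_maximal_bundle_atlas A : Prop :=
  is_bundle_atlas A /\ forall A', is_bundle_atlas A' -> A `<=` A' -> A' = A.

Definition generated_bundle_atlas G : set (triv E B X) :=
  [set t | is_local_triv t /\
     forall s, G s -> triv_compatible t s /\ triv_compatible s t].

End Trivializations.

Definition is_smooth_vector_bundle (Q : quintuple R k) : Prop :=
  [/\ is_manifold (total Q), is_manifold (base Q),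
      smooth_on setT (proj Q)
    & is_maximal_bundle_atlas (proj Q) (trivs Q)].

Record vector_bundle := VectorBundle {
  bundle_data :> quintuple R k;
  bundleP : is_smooth_vector_bundle bundle_data }.

End VectorBundle.

Section VectorAxiom.
Import VectorInternalTheory.

Lemma vector_axiomP (K : fieldType) (X : vectType K) : Vector.axiom (dim X) X.
Proof.
exists v2r; first exact: linearP.
by exists r2v; [exact: v2rK | exact: r2vK].
Qed.

End VectorAxiom.

Definition fib (R : realType) (k : ground) (V : vector_bundle R k)
    (p : base V) : Type := {x : total V | proj V x = p}.

Section Fiber.
Variables (R : realType) (k : ground) (V : vector_bundle R k) (p : base V).
Local Notation fiber := (fib p).
Local Notation X := (typical V).

HB.instance Definition _ := gen_eqMixin fiber.
HB.instance Definition _ := gen_choiceMixin fiber.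

Definition fiber_coord (t : triv (total V) (base V) X) (x : fiber) : X :=
  (triv_map t (sval x)).2.

Lemma fiber_coord_bij t : trivs V t -> triv_dom t p -> bijective (fiber_coord t).
Proof.
have [_ _ _ [[loc _ _] _]] := bundleP V.
move=> /loc [_ _ t1 [g [[fD gD] gK fK _ _]]] tp.
have gP v : proj V (g (p, v)) = p.
  have h : (triv_dom t `*` setT) (p, v) by [].
  by rewrite -(t1 _ (gD _ h)) fK.
exists (fun v => exist _ (g (p, v)) (gP v)) => [[x xp]|v].
- apply: eq_exist => /=; rewrite /fiber_coord /=.
  have tx : triv_dom t (proj V x) by rewrite xp.
  by rewrite -[RHS]gK// -[p in LHS]xp -(t1 _ tx) -surjective_pairing.
- by rewrite /fiber_coord /= fK.
Qed.

Let chosen : {t | trivs V t /\ triv_dom t p}.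
Proof.
by apply: cid; have [_ _ _ [[_ /(_ p)[t ? ?] _] _]] := bundleP V; exists t.
Qed.

Let co : fiber -> X := fiber_coord (sval chosen).

Let co_bij : bijective co.
Proof. by apply: fiber_coord_bij; case: (svalP chosen). Qed.

Let inv_subproof : {g : X -> fiber | cancel co g /\ cancel g co}.
Proof. by apply: cid; have [g] := co_bij; exists g. Qed.

Let oc : X -> fiber := sval inv_subproof.
Let coK : cancel co oc. Proof. by case: (svalP inv_subproof). Qed.
Let ocK : cancel oc co. Proof. by case: (svalP inv_subproof). Qed.

(* The operations of [X] transported along one trivialization around [p];
   [fiber_coord_linear] shows that they do not depend on it. *)
Definition fib_zero : fiber := oc 0.
Definition fib_opp (x : fiber) : fiber := oc (- co x).
Definition fib_add (x y : fiber) : fiber := oc (co x + co y).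
Definition fib_scale (a : scalar R k) (x : fiber) : fiber := oc (a *: co x).

Fact fib_addA : associative fib_add.
Proof. by move=> x y z; rewrite /fib_add !ocK addrA. Qed.
Fact fib_addC : commutative fib_add.
Proof. by move=> x y; rewrite /fib_add addrC. Qed.
Fact fib_add0 : left_id fib_zero fib_add.
Proof. by move=> x; rewrite /fib_add ocK add0r coK. Qed.
Fact fib_addN : left_inverse fib_zero fib_opp fib_add.
Proof. by move=> x; rewrite /fib_add ocK addNr. Qed.

HB.instance Definition _ := GRing.isZmodule.Build fiber
  fib_addA fib_addC fib_add0 fib_addN.

Fact fib_scaleA a b x : fib_scale a (fib_scale b x) = fib_scale (a * b) x.
Proof. by rewrite /fib_scale ocK scalerA. Qed.
Fact fib_scale1 : left_id 1 fib_scale.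
Proof. by move=> x; rewrite /fib_scale scale1r coK. Qed.
Fact fib_scaleDr : right_distributive fib_scale +%R.
Proof. by move=> a x y; rewrite /fib_scale [in RHS]/+%R/= /fib_add !ocK -scalerDr. Qed.
Fact fib_scaleDl x : {morph fib_scale^~ x : a b / a + b}.
Proof. by move=> a b; rewrite /fib_scale [in RHS]/+%R/= /fib_add !ocK -scalerDl. Qed.

HB.instance Definition _ := GRing.Zmodule_isLmodule.Build (scalar R k) fiber
  fib_scaleA fib_scale1 fib_scaleDr fib_scaleDl.

Let co_linear : linear co.
Proof. by move=> a x y; rewrite [in LHS]/+%R/= /fib_add !ocK. Qed.

Fact fib_vect_iso : Vector.axiom (dim X) fiber.
Proof.
have [f fl fbij] := vector_axiomP X; exists (f \o co); last exact: bij_comp.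
by move=> a x y; rewrite /= co_linear fl.
Qed.

HB.instance Definition _ :=
  Lmodule_hasFinDim.Build (scalar R k) fiber fib_vect_iso.

Lemma fiber_coord_linear t : trivs V t -> triv_dom t p -> linear (fiber_coord t).
Proof.
move=> At tp; have [As sp] := svalP chosen.
have [_ _ _ [[_ _ /(_ _ _ At As _ tp sp) [L _ LE]] _]] := bundleP V.
have tE x : fiber_coord t x = L (co x).
  by rewrite /co /fiber_coord (LE _ (svalP x)).
by move=> a x y; rewrite !tE co_linear linearP.
Qed.

(* [linfun] returns the given function when it is linear, which is the case for
   the trivializations of [V] defined at [p]. *)
Definition fiber_iso (t : triv (total V) (base V) X) : 'Hom(fiber, X) :=
  linfun (fiber_coord t).

End Fiber.

Definition multilinear (K : fieldType) (n : nat) (W U : lmodType K)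
    (g : ('I_n -> W) -> U) : Prop :=
  forall (v : 'I_n -> W) (i : 'I_n) (a : K) (x y : W),
    g (@dfwith _ (fun=> W) v i (a *: x + y)) =
    a *: g (@dfwith _ (fun=> W) v i x) + g (@dfwith _ (fun=> W) v i y).

Notation tensor_fun K r s W :=
  (('I_r -> W) -> ('I_s -> 'Hom(W, K^o)) -> K^o) (only parsing).

Definition tensorial (K : fieldType) (W : vectType K) (r s : nat) :
    {pred tensor_fun K r s W} :=
  fun f => `[< (forall w, multilinear (f ^~ w)) /\ (forall v, multilinear (f v)) >].

(* For [r = s = 0] both domains are singletons, so that a tensor amounts to an
   element of [K]. *)
Record tensor (K : fieldType) (r s : nat) (W : vectType K) := Tensor {
  tensor_val :> tensor_fun K r s W;
  tensorP : tensor_val \in @tensorial K W r s }.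

Section TensorSpace.
Variables (K : fieldType) (r s : nat) (W : vectType K).

Fact tensorial_submod : submod_closed (@tensorial K W r s).
Proof.
split=> [|a f g /asboolP[f1 f2] /asboolP[g1 g2]]; apply/asboolP; last first.
  have E v w : (a *: f + g) v w = a *: f v w + g v w by [].
  split=> [w v i b x y|v w i b x y].
    rewrite !E (f1 w) (g1 w) !scalerDr addrACA !scalerA.
    by rewrite [a * b]mulrC.
  rewrite !E (f2 v) (g2 v) !scalerDr addrACA !scalerA.
  by rewrite [a * b]mulrC.
split.
- by move=> w v i b x y; rewrite [in RHS]scaler0 addr0.
- by move=> w v i b x y; rewrite [in RHS]scaler0 addr0.
Qed.

HB.instance Definition _ :=
  GRing.isSubmodClosed.Build K (tensor_fun K r s W) (@tensorial K W r s)
    tensorial_submod.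
HB.instance Definition _ := [isSub for @tensor_val K r s W].
HB.instance Definition _ := [Choice of tensor r s W by <:].
HB.instance Definition _ := [SubChoice_isSubLmodule of tensor r s W by <:].

End TensorSpace.

Section FiniteDimension.
Variable K : fieldType.

Lemma sub_vector_axiom (T : lmodType K) (U : vectType K) (f : {linear T -> U}) :
  injective f -> {n & Vector.axiom n T}.
Proof.
move=> f_inj.
suff /cid[n /cid[g [gl gb]]] :
    exists n (g : T -> 'rV[K]_n), linear g /\ bijective g by exists n; exists g.
pose P n := `[< exists t : n.-tuple T, free (map_tuple f t) >].
have P0 : exists n, P n by exists 0%N; apply/asboolP; exists [tuple]; exact: nil_free.
have Pub n : P n -> (n <= \dim {:U})%N.
  move=> /asboolP[t /eqP tfree]; have := dimvS (subvf <<map_tuple f t>>).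
  by rewrite tfree size_tuple.
case: (ex_maxnP P0 Pub) => n /asboolP[t tfree] nmax.
have tspan x : f x \in <<map_tuple f t>>%VS.
  apply: contrapT => /negP fx; have /nmax : P n.+1; last by rewrite ltnn.
  apply/asboolP; exists [tuple of x :: t].
  by rewrite /= free_cons fx tfree.
exists n, (fun x => \row_i coord (map_tuple f t) i (f x)); split.
  by move=> a x y; apply/rowP => i; rewrite !mxE !linearP.
exists (fun v : 'rV[K]_n => \sum_i v 0 i *: tnth t i) => [x|v].
  apply: f_inj; rewrite linear_sum [RHS](coord_span (tspan x)).
  apply: eq_bigr => i _; rewrite linearZ mxE; congr (_ *: _).
  by rewrite -tnth_nth tnth_map.
apply/rowP => i; rewrite mxE linear_sum.
rewrite (_ : \sum_j _ = \sum_j v 0 j *: (map_tuple f t)`_j); last first.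
  apply: eq_bigr => j _; rewrite linearZ; congr (_ *: _).
  by rewrite -tnth_nth tnth_map.
exact: coord_sum_free.
Qed.

Lemma multilinear_eq0 n (W : vectType K) (U : lmodType K)
    (g : ('I_n -> W) -> U) : multilinear g ->
  (forall h : 'I_n -> 'I_(\dim {:W}), g (fun i => (vbasis {:W})`_(h i)) = 0) ->
  forall v, g v = 0.
Proof.
move=> g_lin g0.
suff gk k v : (forall i : 'I_n, (k <= i)%N ->
    exists j : 'I_(\dim {:W}), v i = (vbasis {:W})`_j) -> g v = 0.
  by move=> v; apply: (gk n) => i; rewrite leqNgt ltn_ord.
elim: k v => [|k IH] v vb.
  have /choice[h hE] := fun i => vb i isT.
  by rewrite (_ : v = fun i => (vbasis {:W})`_(h i)) ?g0//; apply/funext.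
have [nk|kn] := leqP n k.
  by apply: IH => i ki; have := leq_ltn_trans (leq_trans nk ki) (ltn_ord i); rewrite ltnn.
pose i0 := Ordinal kn; pose upd x := @dfwith _ (fun=> W) v i0 x.
have gupd_lin : linear (g \o upd) by move=> a x y; exact: g_lin.
pose G : {linear W -> U} := HB.pack (g \o upd) (GRing.isLinear.Build K W U _ _ gupd_lin).
have -> : v = upd (v i0).
  by apply/funext => i; rewrite /upd; case: dfwithP.
change (G (v i0) = 0); rewrite (coord_vbasis (memvf (v i0))) linear_sum big1// => j _.
rewrite linearZ /= IH ?scaler0// => i ki; rewrite /upd.
case: dfwithP ki => [_|l il kl]; first by exists j.
by apply: vb; rewrite ltn_neqAle kl andbT; apply: contra il => /eqP ?; exact/eqP/val_inj.
Qed.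

Variables (r s : nat) (W : vectType K).

Let index := ({ffun 'I_r -> 'I_(\dim {:W})} *
              {ffun 'I_s -> 'I_(\dim {:'Hom(W, K^o)})})%type.

Let components (f : tensor r s W) : {ffun index -> K^o} :=
  [ffun h : index => f (fun i => (vbasis {:W})`_(h.1 i))
               (fun j => (vbasis {:'Hom(W, K^o)})`_(h.2 j))].

Let components_linear : linear components.
Proof. by move=> a f g; apply/ffunP => h; rewrite !ffunE. Qed.

HB.instance Definition _ := GRing.isLinear.Build K (tensor r s W)
  {ffun index -> K^o} _ components components_linear.

Let components_inj : injective components.
Proof.
apply: raddf_inj => f f0; apply/val_inj/funext => v; apply/funext => w.
have /asboolP[f1 f2] := tensorP f.
apply: multilinear_eq0 (f2 v) _ w => hw.
apply: multilinear_eq0 (f1 _) _ v => hv.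
have := congr1 (fun g : {ffun index -> K^o} => g (finfun hv, finfun hw)) f0.
rewrite !ffunE /= => <-; congr (val f _ _); apply/funext => i; by rewrite ffunE.
Qed.

Let tensor_vect_iso := projT2 (sub_vector_axiom components_inj).

HB.instance Definition _ :=
  Lmodule_hasFinDim.Build K (tensor r s W) tensor_vect_iso.

End FiniteDimension.

Section Pullback.
Variables (K : fieldType) (r s : nat) (W W1 : vectType K) (L : 'Hom(W, W1)).

Definition pullback_fun (f : tensor r s W1) : tensor_fun K r s W :=
  fun v w => f (fun i => L (v i)) (fun j => (w j \o L^-1)%VF).

Fact pullback_tensorial f : pullback_fun f \in @tensorial K W r s.
Proof.
have /asboolP[f1 f2] := tensorP f; apply/asboolP.
have E (A B : Type) n (h : A -> B) (v : 'I_n -> A) i x :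
    (fun j => h (@dfwith _ (fun=> A) v i x j)) =
    @dfwith _ (fun=> B) (h \o v) i (h x).
  apply/funext => j; case: dfwithP => [|l il]; first by rewrite dfwithin.
  by rewrite dfwithout.
split=> [w v i a x y|v w i a x y]; rewrite /pullback_fun.
  by rewrite !(E _ _ _ L) linearP f1.
rewrite !(E _ _ _ (fun u : 'Hom(W, K^o) => (u \o L^-1)%VF)).
by rewrite comp_lfunDl -comp_lfunZl f2.
Qed.

(* The pullback along [L], meant for invertible [L], for which [L^-1] is the
   inverse of [L]. *)
Definition pullback (f : tensor r s W1) : tensor r s W :=
  Tensor (pullback_tensorial f).

End Pullback.

Section TensorBundle.
Variables (R : realType) (k : ground) (V : vector_bundle R k) (r s : nat).
Local Notation B := (base V).
Local Notation X := (typical V).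
Local Notation trivV := (triv (total V) B X).

Definition tensors : Type := {p : B & tensor r s (fib p)}.

Definition tensor_base (x : tensors) : B := tag x.

Definition tensor_coord (t : trivV) (x : tensors) : tensor r s X :=
  pullback (fiber_iso (tag x) t)^-1%VF (tagged x).

Definition Xi (c : chart R B (mdim B)) (t : trivV) (x : tensors) :
    'rV[R]_(mdim B) * tensor r s X :=
  (chart_map c (tensor_base x), tensor_coord t x).

(* [Xi] followed by linear coordinates on the space of tensors of [X]. *)
Definition Xi_chart (c : chart R B (mdim B)) (t : trivV)
    (f : tensor r s X -> 'rV[R]_(real_dim (tensor r s X))) :
    chart R tensors (mdim B + real_dim (tensor r s X)) :=
  Chart (tensor_base @^-1` chart_dom c)
        (fun x => row_mx (Xi c t x).1 (f (Xi c t x).2)).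

Definition Xi_charts : set (chart R tensors (mdim B + real_dim (tensor r s X))) :=
  [set e | exists c t f, [/\ atlas B c, trivs V t, chart_dom c = triv_dom t,
     real_coordinates f & e = Xi_chart c t f]].

Definition tensor_manifold : charted R := Charted (generated_atlas Xi_charts).

Definition tensor_proj : tensor_manifold -> B := tensor_base.

Definition Delta (t : trivV) : triv tensor_manifold B (tensor r s X) :=
  @Triv R k tensor_manifold B (tensor r s X) (triv_dom t)
    (fun x : tensors => (tensor_base x, tensor_coord t x)).

Definition tensor_trivs : set (triv tensor_manifold B (tensor r s X)) :=
  generated_bundle_atlas tensor_proj (Delta @` trivs V).

Definition tensor_bundle : quintuple R k :=
  @Quintuple R k tensor_manifold B tensor_proj (tensor r s X) tensor_trivs.

End TensorBundle.

Arguments Xi_charts {R k} V r s _.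
Arguments Delta {R k V} r s t.
Arguments tensor_trivs {R k} V r s _.

(* Main.v *)
(* Fix local trivializations t and t' of V around p. Evaluating the smooth map
   (q, x) |-> t'(t^-1(q, x)) at a fixed x of X shows that L_q = t'_q o t_q^-1
   depends smoothly on q; exchanging t and t' does the same for L_q^-1, so that
   no inverse matrix has to be differentiated. By multilinearity the components
   of the pullback of a fixed tensor along L_q are polynomials in those of L_q
   and L_q^-1, hence are smooth in q too. This makes the changes of charts
   between the Xi smooth, while Delta and its inverse are represented by the
   identity in the charts Xi and those of the product. *)
From HB Require Import structures.
From mathcomp Require Import all_boot all_order all_algebra complex lra.
From mathcomp Require Import all_classical all_reals all_analysis.
Require Import Defs.

Set Implicit Arguments.
Unset Strict Implicit.
Unset Printing Implicit Defensive.

Import Order.TTheory GRing.Theory Num.Theory numFieldNormedType.Exports.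

Local Open Scope classical_set_scope.
Local Open Scope ring_scope.

(** * Smooth maps between normed spaces *)

(** Charts are total maps whose values matter only on a domain, and charts and trivializations come
    with unrelated domains. Most arguments are therefore reduced to germs: [smooth_in_charts]
    expresses smoothness at one point in one pair of charts. It composes without bookkeeping of
    domains and makes sense on bare types, hence before the charts [Xi_chart] are known to form an
    atlas or to define a topology. The global notions are recovered from germs, maximality of the
    atlases providing the restrictions that they demand. A second obstacle is that tensors are
    linear over the ground field while smoothness is real. Vector-valued smoothness is thus tested
    on real linear forms, and a change of fiber coordinates enters only through its columns, which
    vary smoothly with the base point; [smooth_in_bundle_charts] treats all such maps at once. The
    total space must also be Hausdorff and second countable: tensors over distinct points are
    separated in the base, those over one point in a chart, and a countable base of the base
    manifold selects countably many charts. *)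

Lemma nbhs_open (T : topologicalType) (x : T) (P : set T) :
  nbhs x P -> exists2 U, open_nbhs x U & U `<=` P.
Proof. by rewrite nbhsE. Qed.

Section Differentials.
Variable R : realType.

Lemma near_eq_diff (V W : normedModType R) (f g : V -> W) x :
  (\near x, f x = g x) -> differentiable f x ->
  differentiable g x /\ 'd g x = 'd f x :> (V -> W).
Proof.
move=> fg df.
have gE : g \o shift x = cst (g x) + 'd f x +o_ 0 id.
  apply/eqaddoP => e e0; move/diff_locally: (df) => /eqaddoP/(_ _ e0).
  have : \forall h \near 0, f (h + x) = g (h + x).
    by move: fg; rewrite (near_shift 0 x) /= subr0.
  apply: filterS2 => h fgh; congr (_ <= _); congr (`|_|).
  by rewrite !fctE /= fgh (nbhs_singleton fg).
have dE : 'd g x = 'd f x :> (V -> W).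
  by apply: diff_unique gE; exact: diff_continuous.
split=> //; apply/diff_locallyP; rewrite dE; split=> //.
exact: diff_continuous.
Qed.

Lemma sub_Ck (V W : normedModType R) k (O O' : set V) (f : V -> W) :
  O' `<=` O -> Ck k O f -> Ck k O' f.
Proof.
move=> sO; elim: k f => [|k IH] f /=; first by move=> cf x /sO /cf.
by move=> [df Cf]; split=> [x /sO /df//|v]; exact: IH.
Qed.

Lemma CkW (V W : normedModType R) k (O : set V) (f : V -> W) :
  Ck k.+1 O f -> Ck k O f.
Proof.
elim: k f => [|k IH] f; first by move=> [df _] x /df/differentiable_continuous.
by move=> [df Cf]; split=> // v; apply: IH; exact: Cf.
Qed.

(** The sum, product and chain rules give formulas for ['d f x v] only at points of [O], and
    inductions on [k] exploit them through this lemma. Openness of [O] turns agreement on [O] into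
    agreement near each point, hence into equality of differentials there. *)
Lemma eq_Ck (V W : normedModType R) k (O : set V) (f g : V -> W) :
  open O -> (forall x, O x -> f x = g x) -> Ck k O f -> Ck k O g.
Proof.
move=> oO; have nO x (P : V -> Prop) : O x -> (forall y, O y -> P y) -> \near x, P x.
  by move=> Ox OP; apply: filterS OP _; exact: open_nbhs_nbhs.
elim: k f g => [|k IH] f g fg /=.
  move=> cf x Ox; rewrite /prop_for /continuous_at -fg//.
  apply: cvg_trans (cf _ Ox); apply: near_eq_cvg.
  exact: nO.
move=> [df Cf]; have D x Ox := near_eq_diff (nO x _ Ox fg) (df _ Ox).
split=> [x /D[]//|v]; apply: IH (Cf v) => x /D[_ E].
by rewrite -(congr1 (@^~ v) E).
Qed.

Lemma Ck_local (V W : normedModType R) k (O : set V) (f : V -> W) :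
  (forall x, O x -> exists2 U, U x & Ck k U f) -> Ck k O f.
Proof.
elim: k f => [|k IH] f /=; first by move=> H x /H [U Ux]; apply.
move=> H; split=> [x /H [U Ux [+ _]]|v]; first exact.
by apply: IH => x /H [U Ux [_ +]]; exists U.
Qed.

Lemma Ck_cst (V W : normedModType R) k (O : set V) (a : W) : Ck k O (fun=> a).
Proof.
elim: k a => [|k IH] a /=; first by move=> x _; exact: cst_continuous.
split=> [x _|v]; first exact: differentiable_cst.
rewrite (_ : (fun x => _) = fun=> 0); first exact: IH.
by apply/funext => x; exact: (congr1 (@^~ v) (diff_cst a x)).
Qed.

Lemma Ck_lin (V W : normedModType R) k (O : set V) (f : {linear V -> W}) :
  continuous f -> Ck k O f.
Proof.
move=> cf; case: k => [|k] /=; first by move=> x _; exact: cf.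
split=> [x _|v]; first exact: linear_differentiable.
rewrite (_ : (fun x => _) = fun=> f v); first exact: Ck_cst.
by apply/funext => x; rewrite diff_lin.
Qed.

Lemma CkD (V W : normedModType R) k (O : set V) (f g : V -> W) : open O ->
  Ck k O f -> Ck k O g -> Ck k O (fun x => f x + g x).
Proof.
move=> oO; elim: k f g => [|k IH] f g /=.
  by move=> cf cg x Ox; apply: continuousD; [exact: cf|exact: cg].
move=> [df Cf] [dg Cg]; split=> [x Ox|v].
  by apply: differentiableD; [exact: df|exact: dg].
apply: eq_Ck (IH _ _ (Cf v) (Cg v)) => // x Ox.
exact/esym/(congr1 (@^~ v) (diffD (df _ Ox) (dg _ Ox))).
Qed.

Lemma CkZl (V W : normedModType R) k (O : set V) (a : V -> R) (w : W) : open O ->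
  Ck k O a -> Ck k O (fun x => a x *: w).
Proof.
move=> oO; elim: k a => [|k IH] a /=.
  by move=> ca x Ox; apply: continuousZr_tmp; exact: ca.
move=> [da Ca]; split=> [x Ox|v]; first by apply: differentiableZl; exact: da.
by apply: eq_Ck (IH _ (Ca v)) => // x Ox;
  exact/esym/(congr1 (@^~ v) (diffZl w (da _ Ox))).
Qed.

Lemma CkM (V : normedModType R) k (O : set V) (f g : V -> R) : open O ->
  Ck k O f -> Ck k O g -> Ck k O (fun x => f x * g x).
Proof.
move=> oO; elim: k f g => [|k IH] f g.
  by move=> cf cg x Ox; apply: continuousM; [exact: cf|exact: cg].
move=> Cf Cg; have [[df Cdf] [dg Cdg]] := (Cf, Cg); split=> [x Ox|v].
  by apply: differentiableM; [exact: df|exact: dg].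
apply: eq_Ck (CkD oO (IH _ _ (CkW Cf) (Cdg v)) (IH _ _ (CkW Cg) (Cdf v))) => // x Ox.
exact/esym/(congr1 (@^~ v) (diffM (df _ Ox) (dg _ Ox))).
Qed.

Lemma Ck_sum (V W : normedModType R) k (O : set V) (I : Type) (s : seq I)
    (f : I -> V -> W) : open O -> (forall i, Ck k O (f i)) ->
  Ck k O (fun x => \sum_(i <- s) f i x).
Proof.
move=> oO Cf; elim: s => [|i s IH].
  rewrite (_ : (fun x => _) = fun=> 0); first exact: Ck_cst.
  by apply/funext => x; rewrite big_nil.
rewrite (_ : (fun x => _) = fun x => f i x + \sum_(j <- s) f j x).
  exact: CkD.
by apply/funext => x; rewrite big_cons.
Qed.

Lemma Ck_rV (V : normedModType R) k (O : set V) n (f : V -> 'rV[R]_n) :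
  open O -> (forall j, Ck k O (fun x => f x 0 j)) -> Ck k O f.
Proof.
move=> oO Cf; rewrite (_ : f = fun x => \sum_j f x 0 j *: delta_mx 0 j);
  last first.
  by apply/funext => x; exact: row_sum_delta.
by apply: Ck_sum => // j; exact: CkZl.
Qed.

Lemma Ck_comp_lin (V W U : normedModType R) k (O : set V) (l : {linear W -> U})
    (f : V -> W) : open O -> continuous l -> Ck k O f -> Ck k O (l \o f).
Proof.
move=> oO cl; elim: k f => [|k IH] f /=.
  by move=> cf x Ox; apply: continuous_comp; [exact: cf|exact: cl].
have dl y : differentiable l y by exact: linear_differentiable.
move=> [df Cf]; split=> [x Ox|v].
  by apply: differentiable_comp => //; exact: df.
apply: eq_Ck (IH _ (Cf v)) => // x Ox.
rewrite (congr1 (@^~ v) (diff_comp (df _ Ox) (dl (f x)))) /=.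
by rewrite (congr1 (@^~ ('d f x v)) (diff_lin (f x) cl)).
Qed.

Lemma Ck_coord (V : normedModType R) k (O : set V) n (f : V -> 'rV[R]_n) j :
  open O -> Ck k O f -> Ck k O (fun x => f x 0 j).
Proof.
move=> oO Cf.
have lc : linear (fun M : 'rV[R]_n => M 0 j) by move=> a x y; rewrite !mxE.
pose c : {linear 'rV[R]_n -> R} := HB.pack (fun M : 'rV[R]_n => M 0 j)
  (GRing.isLinear.Build _ _ _ _ _ lc).
by apply: (@Ck_comp_lin _ _ _ _ _ c) => //; exact: coord_continuous.
Qed.

(** [Ck] only speaks of differentials in a fixed direction, whereas the chain rule applies
    ['d g (f x)] to the moving vector ['d f x v]. Expanding this vector in the standard basis leaves
    the fixed directions [delta_mx 0 j], and scalar values of [g] make each term a product to which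
    [CkM] applies. *)
Lemma Ck_comp_scalar (V : normedModType R) k (O : set V) m (U : set 'rV[R]_m)
    (f : V -> 'rV[R]_m) (g : 'rV[R]_m -> R) : open O ->
  (forall x, O x -> U (f x)) -> Ck k O f -> Ck k U g -> Ck k O (g \o f).
Proof.
move=> oO OU; elim: k f g OU => [|k IH] f g OU.
  by move=> cf cg x Ox; exact: continuous_comp (cf _ Ox) (cg _ (OU _ Ox)).
move=> Cf Cg; have [[df Cdf] [dg Cdg]] := (Cf, Cg); split=> [x Ox|v].
  exact: differentiable_comp (df _ Ox) (dg _ (OU _ Ox)).
have C : Ck k O (fun x => \sum_j ('d f x v) 0 j * ('d g (f x) (delta_mx 0 j))).
  apply: Ck_sum => // j; have Cj := Ck_coord j oO (Cdf v).
  exact: CkM oO Cj (IH f (fun y => 'd g y (delta_mx 0 j)) OU (CkW Cf) (Cdg _)).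
apply: eq_Ck C => // x Ox.
rewrite (congr1 (@^~ v) (diff_comp (df _ Ox) (dg _ (OU _ Ox)))) /=.
rewrite [in RHS](row_sum_delta ('d f x v)) linear_sum.
by apply: eq_bigr => j _; rewrite linearZ.
Qed.

Lemma Ck_comp (V : normedModType R) k (O : set V) m n (U : set 'rV[R]_m)
    (f : V -> 'rV[R]_m) (g : 'rV[R]_m -> 'rV[R]_n) : open O -> open U ->
  (forall x, O x -> U (f x)) -> Ck k O f -> Ck k U g -> Ck k O (g \o f).
Proof.
move=> oO oU OU Cf Cg; apply: Ck_rV => // j.
by apply: (Ck_comp_scalar oO OU Cf (g := fun y => g y 0 j)); exact: Ck_coord.
Qed.

Lemma Ck_rV_lin (W : normedModType R) k m (O : set 'rV[R]_m)
    (f : 'rV[R]_m -> W) : open O -> linear f -> Ck k O f.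
Proof.
move=> oO fl.
pose g : {linear 'rV[R]_m -> W} := HB.pack f (GRing.isLinear.Build _ _ _ _ f fl).
rewrite (_ : f = fun u => \sum_j u 0 j *: f (delta_mx 0 j)); last first.
  apply/funext => u; rewrite -[LHS]/(g u) [in LHS](row_sum_delta u) linear_sum.
  by apply: eq_bigr => j _; rewrite linearZ.
apply: Ck_sum => // j; apply: CkZl => //; apply: Ck_coord => //.
by apply: (@Ck_lin _ _ _ _ (@idfun 'rV[R]_m)) => x; exact: cvg_id.
Qed.

Definition smooth_at (V W : normedModType R) (f : V -> W) (x : V) : Prop :=
  exists2 O, open_nbhs x O & Cinfty O f.

Lemma CinftyP (V W : normedModType R) (O : set V) (f : V -> W) : open O ->
  Cinfty O f <-> forall x, O x -> smooth_at f x.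
Proof.
move=> oO; split=> [Cf x Ox|H k]; first by exists O.
by apply: Ck_local => x /H [U [_ Ux] Cf]; exists U.
Qed.

Lemma near_eq_smooth_at (V W : normedModType R) (f g : V -> W) x :
  (\near x, f x = g x) -> smooth_at f x -> smooth_at g x.
Proof.
move=> /nbhs_open[U xU Ufg] [ O xO Cf]; exists (O `&` U);
  first exact: open_nbhsI.
move=> k; apply: (@eq_Ck _ _ k _ f); first by case: xO xU => ? _ [? _];
  exact: openI.
  by move=> y [_ /Ufg].
by apply: sub_Ck (Cf k) => y [].
Qed.

Lemma smooth_at_continuous (V W : normedModType R) (f : V -> W) x :
  smooth_at f x -> {for x, continuous f}.
Proof. by case=> O [_ Ox] /(_ 0%N) /(_ _ Ox). Qed.

Lemma smooth_at_cst (V W : normedModType R) (a : W) (x : V) : smooth_at (fun=> a) x.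
Proof. by exists setT; [exact: open_nbhsT|move=> k; exact: Ck_cst]. Qed.

Lemma smooth_atD (V W : normedModType R) (f g : V -> W) x :
  smooth_at f x -> smooth_at g x -> smooth_at (fun y => f y + g y) x.
Proof.
move=> [ O xO Cf] [U xU Cg]; have [oI xI] := open_nbhsI xO xU.
exists (O `&` U) => // k; apply: CkD => //; [exact: sub_Ck (Cf k)|exact: sub_Ck (Cg k)].
Qed.

Lemma smooth_atM (V : normedModType R) (f g : V -> R) x :
  smooth_at f x -> smooth_at g x -> smooth_at (fun y => f y * g y) x.
Proof.
move=> [ O xO Cf] [U xU Cg]; have [oI xI] := open_nbhsI xO xU.
exists (O `&` U) => // k; apply: CkM => //; [exact: sub_Ck (Cf k)|exact: sub_Ck (Cg k)].
Qed.

Lemma smooth_atZl (V W : normedModType R) (f : V -> R) (w : W) x :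
  smooth_at f x -> smooth_at (fun y => f y *: w) x.
Proof. by case=> O [oO Ox] Cf; exists O => // k; exact: CkZl. Qed.

Lemma smooth_at_sum (V W : normedModType R) (I : Type) (s : seq I)
    (f : I -> V -> W) x : (forall i, smooth_at (f i) x) ->
  smooth_at (fun y => \sum_(i <- s) f i y) x.
Proof.
move=> Cf; elim: s => [|i s IH].
  rewrite (_ : (fun y => _) = fun=> 0); first exact: smooth_at_cst.
  by apply/funext => y; rewrite big_nil.
rewrite (_ : (fun y => _) = fun y => f i y + \sum_(j <- s) f j y).
  exact: smooth_atD.
by apply/funext => y; rewrite big_cons.
Qed.

Lemma smooth_at_rV (V : normedModType R) n (f : V -> 'rV[R]_n) x :
  (forall j, smooth_at (fun y => f y 0 j) x) -> smooth_at f x.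
Proof.
move=> Cf; rewrite (_ : f = fun y => \sum_j f y 0 j *: delta_mx 0 j);
  last first.
  by apply/funext => y; exact: row_sum_delta.
by apply: smooth_at_sum => j; exact: smooth_atZl.
Qed.

Lemma smooth_at_lin (W : normedModType R) m (f : 'rV[R]_m -> W) x :
  linear f -> smooth_at f x.
Proof.
move=> fl; exists setT; first exact: open_nbhsT.
by move=> k; apply: Ck_rV_lin => //; exact: openT.
Qed.

Lemma smooth_at_comp (V : normedModType R) m n
    (f : V -> 'rV[R]_m) (g : 'rV[R]_m -> 'rV[R]_n) x :
  smooth_at f x -> smooth_at g (f x) -> smooth_at (g \o f) x.
Proof.
move=> Cf [U [oU Ux] Cg]; have cf := smooth_at_continuous Cf.
have [ O [oO Ox] {}Cf] := Cf.
have /nbhs_open[U' xU' fU'] := cf _ (open_nbhs_nbhs (conj oU Ux)).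
have [oI xI] := open_nbhsI (conj oO Ox) xU'.
exists (O `&` U') => // k; apply: (@Ck_comp _ _ _ _ _ U) => //.
  by move=> y [_ /fU'].
exact: sub_Ck (Cf k).
Qed.

Lemma smooth_at_coord (V : normedModType R) n (f : V -> 'rV[R]_n) x j :
  smooth_at f x -> smooth_at (fun y => f y 0 j) x.
Proof. by case=> O [oO Ox] Cf; exists O => // k; exact: Ck_coord. Qed.

Lemma smooth_at_comp_scalar (V : normedModType R) m
    (f : V -> 'rV[R]_m) (g : 'rV[R]_m -> R) x :
  smooth_at f x -> smooth_at g (f x) -> smooth_at (g \o f) x.
Proof.
move=> Cf [U [oU Ux] Cg].
(* A scalar is read as a row of length one, which reduces the claim to row-valued composition. *)
have gE : g \o f = (fun y => ((fun z => g z *: delta_mx 0 0 : 'rV_1) \o f) y 0 0).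
  by apply/funext => y; rewrite /= !mxE mulr1.
rewrite gE; apply/smooth_at_coord/smooth_at_comp => //.
by apply: smooth_atZl; exists U.
Qed.

End Differentials.

(** * Smooth maps in charts *)

Section ChartGerms.
Variable R : realType.

(* For [c] in the atlas of a charted set and [x] in its domain, this is the
   neighborhood filter of [x], see [nbhs_chart]. *)
Definition near_chart (M : Type) n (c : chart R M n) (x : M) : set_system M :=
  [set P | \forall y \near chart_map c x,
     forall z, chart_dom c z -> chart_map c z = y -> P z].

#[global] Instance near_chart_filter (M : Type) n (c : chart R M n) x :
  Filter (near_chart c x).
Proof.
split.
- by rewrite /near_chart /=; exact: filterE.
- move=> P Q; rewrite /near_chart /=; apply: filterS2 => y Py Qy z cz zy;
  split; [exact: Py|exact: Qy].
- move=> P Q PQ; rewrite /near_chart /=; apply: filterS => y Py z cz zy;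
  exact/PQ/Py.
Qed.

#[global] Typeclasses Opaque near_chart.

Lemma near_chart_singleton (M : Type) n (c : chart R M n) x (P : set M) :
  chart_dom c x -> near_chart c x P -> P x.
Proof. by move=> cx /nbhs_singleton; exact. Qed.

(** Requiring that points near [x] be sent into the domain of [d] builds continuity at [x] into the
    definition; this is what makes such germs compose. *)
Definition smooth_in_charts (M N : Type) m n (c : chart R M m) (d : chart R N n)
    (f : M -> N) (x : M) : Prop :=
  exists2 F, smooth_at F (chart_map c x) &
    near_chart c x [set z | chart_dom d (f z) /\
      F (chart_map c z) = chart_map d (f z)].

Lemma near_chart_smooth (M N : Type) m n (c : chart R M m) (d : chart R N n)
    (f : M -> N) x (P : set N) : chart_dom c x ->
  smooth_in_charts c d f x -> near_chart d (f x) P -> near_chart c x (f @^-1` P).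
Proof.
move=> cx [F sF nF] nP; have [dx Fx] := near_chart_singleton cx nF.
rewrite /near_chart /= -Fx in nP nF *.
have {}nP := smooth_at_continuous sF nP.
apply: (@filterS2 _ (nbhs (chart_map c x)) _ _ _ _ _ nF nP).
move=> y dF nPy z cz zy; have [dz Fz] := dF z cz zy.
by apply: nPy => //; rewrite -Fz zy.
Qed.

Lemma smooth_in_charts_comp (M N P : Type) m n p (c : chart R M m)
    (d : chart R N n) (e : chart R P p) (f : M -> N) (g : N -> P) x :
  chart_dom c x -> smooth_in_charts c d f x -> smooth_in_charts d e g (f x) ->
  smooth_in_charts c e (g \o f) x.
Proof.
move=> cx sf [G sG nG]; have nG' := near_chart_smooth cx sf nG.
have [F sF nF] := sf; have [dx Fx] := near_chart_singleton cx nF.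
exists (G \o F); first by apply: smooth_at_comp; rewrite ?Fx.
by apply: filterS2 nF nG' => z [dz Fz] [ez Gz]; split=> //=; rewrite Fz.
Qed.

Section Transitions.
Variables (M : Type) (n : nat).
Implicit Types (c d e : chart R M n) (A G : set (chart R M n)).

Lemma near_chart_dom c x : near_chart c x (chart_dom c).
Proof. by rewrite /near_chart /=; exact: filterE. Qed.

Lemma smooth_in_charts_id c x : smooth_in_charts c c id x.
Proof.
by exists id; [exact: smooth_at_lin|exact: filterS (near_chart_dom c x)].
Qed.

Lemma smooth_transitionP c d : is_chart c ->
  smooth_transition c d <->
  forall x, chart_dom c x -> chart_dom d x -> smooth_in_charts c d id x.
Proof.
move=> [c_inj c_open]; split.
  move=> [oO [F [CF FE]]] x cx dx; exists F.
    by move/(CinftyP _ oO): CF; apply; exists x.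
  have : nbhs (chart_map c x) (chart_overlap c d).
    by apply: open_nbhs_nbhs; split=> //; exists x.
  apply: filterS => _ [z [cz dz] <-] w cw wz.
  by rewrite (c_inj _ _ _ _ wz) ?inE//; split=> //; exact: FE.
move=> H; have oO : open (chart_overlap c d).
  rewrite openE => _ [x [cx dx] <-]; have [F _ +] := H _ cx dx.
  rewrite /near_chart /= => nF.
  have : nbhs (chart_map c x) (chart_image c).
    by apply: open_nbhs_nbhs; split=> //; exists x.
  apply: filterS2 nF => y + [z cz zy]; rewrite -zy => /(_ z cz erefl)[dz _].
  by exists z.
split=> //.
(* The germs at different points come with different representatives. Since [c] is injective on its
   domain, the value at a point of the overlap is forced, so one global [F] can be chosen; it agrees
   with each representative near the corresponding point. Off the overlap the value is 0. *)
have /choice[F FE] : forall y, exists v, forall x, chart_dom c x -> chart_dom d x ->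
    chart_map c x = y -> v = chart_map d x.
  move=> y; have [[x [cx dx xy]]|nx] :=
      pselect (exists x, [/\ chart_dom c x, chart_dom d x & chart_map c x = y]).
    exists (chart_map d x) => z cz dz zy.
    by rewrite (c_inj _ _ _ _ (etrans xy (esym zy))) ?inE.
  by exists 0 => x cx dx xy; exfalso; apply: nx; exists x.
exists F; split; last by move=> x cx dx; exact: FE.
apply/(CinftyP _ oO) => _ [x [cx dx] <-]; have [F' sF' +] := H _ cx dx.
rewrite /near_chart /= => nF'.
apply: near_eq_smooth_at sF'.
have : nbhs (chart_map c x) (chart_image c).
  by apply: open_nbhs_nbhs; split=> //; exists x.
apply: filterS2 nF' => y + [z cz zy]; rewrite -zy => /(_ z cz erefl)[dz ->].
by apply/esym; exact: FE.
Qed.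

Lemma atlas_smooth_id A c d x : is_atlas A -> A c -> A d -> chart_dom c x ->
  chart_dom d x -> smooth_in_charts c d id x.
Proof.
move=> [cP _ AP] Ac Ad cx dx; have [/smooth_transitionP t _] := AP _ _ Ac Ad.
exact: t (cP _ Ac) _ cx dx.
Qed.

(** Two charts compatible with [G] need not share a domain with one single chart of [G], but near
    each common point the transition factors through a chart of [G], and germs compose. Maximality
    holds because any larger atlas still contains [G]. *)
Lemma generated_atlasP G : is_atlas G ->
  is_maximal_atlas (generated_atlas G) /\ G `<=` generated_atlas G.
Proof.
move=> AG; have [GP Gcov Gcomp] := AG.
have sG : G `<=` generated_atlas G.
  by move=> c Gc; split=> [|d Gd]; [exact: GP|exact: Gcomp].
split=> //; split; first split.
- by move=> c [].
- by move=> x; have [c /sG ? ?] := Gcov x; exists c.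
- have T c d : generated_atlas G c -> generated_atlas G d -> smooth_transition c d.
    move=> [cP cG] [dP dG]; apply/smooth_transitionP => // x cx dx.
    have [e Ge ex] := Gcov x.
    apply: (@smooth_in_charts_comp _ _ _ _ _ _ c e d id id) => //.
    + by have [/smooth_transitionP t _] := cG _ Ge; exact: t.
    + by have [_ /smooth_transitionP t] := dG _ Ge; apply: t => //; exact: GP.
  by move=> c d Gc Gd; split; exact: T.
- move=> A' [A'P _ A'comp] sA'; apply/seteqP; split=> // c A'c.
  by split=> [|d /sG/sA']; [exact: A'P|exact: A'comp].
Qed.

Lemma maximal_atlas_mem A c : is_maximal_atlas A -> is_chart c ->
  (forall d, A d -> chart_compatible c d) -> A c.
Proof.
move=> [AP Amax] cP cA; have [[gA _] sA] := generated_atlasP AP.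
by rewrite -(Amax _ gA sA).
Qed.

Definition chart_restr (W : set M) c : chart R M n :=
  Chart (chart_dom c `&` W) (chart_map c).

(** Openness of [W] is phrased with [near_chart] because [M] is a bare type here, without
    topology. *)
Lemma chart_restr_mem A c (W : set M) : is_maximal_atlas A -> A c ->
  (forall x, chart_dom c x -> W x -> near_chart c x W) -> A (chart_restr W c).
Proof.
move=> AM Ac nW; have [AP _] := AM; have [cP _ _] := AP.
have [c_inj c_open] := cP _ Ac.
have rP : is_chart (chart_restr W c).
  split; first by move=> x y /[!inE] -[xc _] [yc _]; apply: c_inj; rewrite inE.
  rewrite openE => _ [x [cx Wx] <-] /=.
  have : nbhs (chart_map c x) (chart_image c).
    by apply: open_nbhs_nbhs; split=> //; exists x.
  have := nW _ cx Wx; rewrite /near_chart /= => nWx;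
    apply: filterS2 nWx => y + [z cz zy]; rewrite -zy => /(_ z cz erefl) Wz.
  by exists z.
apply: maximal_atlas_mem => // d Ad; split; apply/smooth_transitionP => //.
- move=> x [cx Wx] dx; have [F sF nF] := atlas_smooth_id AP Ac Ad cx dx.
  exists F => //; move: nF; rewrite /near_chart /=.
  by apply: filterS => y H z [cz _]; exact: H.
- exact: cP.
- move=> x dx [cx Wx].
  have sdc := atlas_smooth_id AP Ad Ac dx cx; have [F sF nF] := sdc.
  exists F => //.
  apply: filterS2 nF (near_chart_smooth dx sdc (nW _ cx Wx)) => z [cz Fz] Wz.
  by split; [split|exact: Fz].
Qed.

End Transitions.

Section ChartTopology.
Variable M : charted R.
Lemma open_chart_preimage c (O : set 'rV[R]_(mdim M)) : atlas M c -> open O ->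
  open (chart_dom c `&` chart_map c @^-1` O : set M).
Proof.
move=> Ac oO; exists [set chart_dom c `&` chart_map c @^-1` O]; last first.
  by rewrite bigcup_set1.
by move=> _ ->; apply: (@finI_from1 _ _ _ id); exists c => //; exists O.
Qed.

Lemma open_chart_dom c : atlas M c -> open (chart_dom c : set M).
Proof. by move=> Ac; rewrite -[chart_dom c]setIT;
  exact: open_chart_preimage openT. Qed.

Hypothesis AM : is_atlas (atlas M).

(** The topology is given by a subbase involving all charts. A basic neighborhood is a finite
    intersection of sets read in other charts, each of which is a neighborhood in [c] because
    transitions are continuous. *)
Lemma nbhs_chart c (x : M) : atlas M c -> chart_dom c x ->
  nbhs x = near_chart c x.
Proof.
move=> Ac cx; apply/seteqP; split=> P.
  move=> /nbhs_open[B [[I sI <-] [W IW Wx]] BP].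
  have {BP} : W `<=` P by move=> y Wy; apply: BP; exists W.
  move=> WP; apply: filterS WP _.
  have {IW sI}[J sJ WE] := sI _ IW; rewrite -WE in Wx *.
  apply: filter_bigI => U UJ; have := Wx _ UJ.
  have := sJ _ UJ; rewrite inE => -[d Ad [ O oO ->]] [dx Ox].
  apply: (near_chart_smooth (P := chart_dom d `&` chart_map d @^-1` O) cx
    (atlas_smooth_id AM Ac Ad cx dx)).
  have : nbhs (chart_map d x) O by exact: open_nbhs_nbhs.
  rewrite /near_chart /=; apply: filterS => y Oy z dz zy.
  by split=> //; rewrite /preimage /= zy.
rewrite /near_chart /= => /nbhs_open[ O [oO Ox] OP].
rewrite nbhsE /=; exists (chart_dom c `&` chart_map c @^-1` O).
  by split=> //; exact: open_chart_preimage.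
by move=> z [cz Oz]; exact: OP Oz z cz erefl.
Qed.

End ChartTopology.

Section SmoothOn.
Variables M N : charted R.
Implicit Types f : M -> N.

Lemma smooth_on_open (D : set M) f : smooth_on D f -> open D.
Proof.
move=> sf; rewrite openE => x /sf[c [d [Ac _ [cx cD _ _]]]].
apply: filterS cD _; apply: open_nbhs_nbhs; split=> //; exact: open_chart_dom.
Qed.

Lemma smooth_onW (D : set M) f c d x :
  is_atlas (atlas M) -> is_atlas (atlas N) -> smooth_on D f -> D x ->
  atlas M c -> atlas N d -> chart_dom c x -> chart_dom d (f x) ->
  smooth_in_charts c d f x.
Proof.
move=> AM AN sf /sf[c' [d' [Ac' Ad' [c'x c'D fc' [F [CF FE]]]]]] Ac Ad cx dfx.
have oc' : open (chart_image c') by have [/(_ _ Ac')[]] := AM.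
have d'fx : chart_dom d' (f x) by apply: fc'; exists x.
have sf' : smooth_in_charts c' d' f x.
  exists F; first by move/(CinftyP _ oc'): CF; apply; exists x.
  apply: filterS (near_chart_dom c' x) => z c'z.
  by split; [apply: fc'; exists z|exact: FE].
apply: (@smooth_in_charts_comp _ _ _ _ _ _ c c' d id f) => //.
  exact: atlas_smooth_id AM Ac Ac' cx c'x.
apply: (@smooth_in_charts_comp _ _ _ _ _ _ c' d' d f id) => //.
exact: atlas_smooth_id AN Ad' Ad d'fx dfx.
Qed.

(** [smooth_on] asks for a chart whose whole domain lies in [D], goes into the domain of [d] and
    carries one representative. Restricting [c] to a small open set achieves this, and maximality
    keeps the restriction in the atlas. *)
Lemma smooth_onI (D : set M) f : is_maximal_atlas (atlas M) -> open D ->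
  (forall x, D x -> exists c d, [/\ atlas M c, atlas N d, chart_dom c x &
    smooth_in_charts c d f x]) -> smooth_on D f.
Proof.
move=> AM oD H x Dx; have [c [d [Ac Ad cx [F [ O [oO Ox] CF] nF]]]] := H x Dx.
have := AM.1 => AM1.
pose P := D `&` [set z | chart_dom d (f z) /\ F (chart_map c z) = chart_map d (f z)]
  `&` (chart_dom c `&` chart_map c @^-1` O).
have nP : nbhs x P.
  apply: filterI; last first.
    by apply: open_nbhs_nbhs; split=> //; exact: open_chart_preimage.
  apply: filterI; first exact: open_nbhs_nbhs.
  by rewrite (nbhs_chart AM1 Ac cx).
have [W [oW Wx] WP] := nbhs_open nP.
exists (chart_restr W c), d; split=> //.
  apply: chart_restr_mem => // y cy Wy.
  by rewrite -(nbhs_chart AM1 Ac cy); exact: open_nbhs_nbhs.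
split=> [//|z [_ /WP[[]]]//|_ [z [_ /WP[[_ [? _]] _]] <-]//|].
exists F; split=> [k|z [_ /WP[[_ []]]]//].
apply: sub_Ck (CF k) => _ [z [_ /WP[_ [_ Oz]]] <-].
exact: Oz.
Qed.

Lemma sub_smooth_on (D D' : set M) f : is_maximal_atlas (atlas M) ->
  is_atlas (atlas N) -> open D' -> D' `<=` D -> smooth_on D f -> smooth_on D' f.
Proof.
move=> AM AN oD' D'D sf; have [AM1 _] := AM.
apply: smooth_onI => // x /D'D Dx.
have [c [d [Ac Ad [cx _ fd _]]]] := sf _ Dx; exists c, d; split=> //.
by apply: (smooth_onW AM1 AN sf) => //; apply: fd; exists x.
Qed.

Lemma smooth_on_continuous (D : set M) f x : is_atlas (atlas M) ->
  is_atlas (atlas N) -> smooth_on D f -> D x -> {for x, continuous f}.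
Proof.
move=> AM AN sf Dx P; have [c [d [Ac Ad [cx _ fd _]]]] := sf _ Dx.
have dfx : chart_dom d (f x) by apply: fd; exists x.
rewrite /= (nbhs_chart AN Ad dfx) (nbhs_chart AM Ac cx) => nP.
exact: near_chart_smooth cx (smooth_onW AM AN sf Dx Ac Ad cx dfx) nP.
Qed.

Lemma smooth_on_open_preimage (D : set M) (W : set N) f : is_atlas (atlas M) ->
  is_atlas (atlas N) -> smooth_on D f -> open W -> open (D `&` f @^-1` W).
Proof.
move=> AM AN sf oW; rewrite openE => x [Dx Wfx]; apply: filterI.
  by apply: open_nbhs_nbhs; split=> //; exact: smooth_on_open sf.
by apply: (smooth_on_continuous AM AN sf Dx); exact: open_nbhs_nbhs.
Qed.

End SmoothOn.

End ChartGerms.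

(** * Smooth maps into vector spaces over the ground field *)

Section RealForms.
Variables (R : realType) (k : ground).
Local Notation K := (scalar R k).

(** Linearity over [R] of a form on a space over the ground field, stated through [of_real] so that
    [X] needs no second module structure. *)
Definition real_form (X : lmodType K) (l : X -> R) : Prop :=
  forall a x y, l (of_real k a *: x + y) = a * l x + l y.

Lemma real_form_comp (X Y : lmodType K) (h : X -> Y) (l : Y -> R) :
  linear h -> real_form l -> real_form (l \o h).
Proof. by move=> hl ll a x y; rewrite /= hl ll. Qed.

Lemma real_form0 (X : lmodType K) (l : X -> R) : real_form l -> l 0 = 0.
Proof.
move=> ll; have := ll 1 0 0.
rewrite (_ : of_real k 1 = 1); last by case: (k).
by rewrite scale1r addr0 mul1r -[LHS]addr0 => /addrI.
Qed.

Lemma real_formD (X : lmodType K) (l : X -> R) x y : real_form l ->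
  l (x + y) = l x + l y.
Proof.
move=> ll; have := ll 1 x y.
by rewrite (_ : of_real k 1 = 1) ?scale1r ?mul1r//; case: (k).
Qed.

Lemma real_formZ (X : lmodType K) (l : X -> R) a x : real_form l ->
  l (of_real k a *: x) = a * l x.
Proof. by move=> ll; rewrite -[X in l X]addr0 ll (real_form0 ll) addr0. Qed.

End RealForms.

(* [l] and [b] are dual bases of the ground field over [R]. *)
Lemma real_form_scale (R : realType) (k : ground) :
  exists s (l : 'I_s -> scalar R k -> R) (b : 'I_s -> scalar R k),
    (forall i, real_form (l i : (scalar R k)^o -> R)) /\
    forall a, a = \sum_i of_real k (l i a) * b i.
Proof.
case: k.
  exists 1%N, (fun=> id), (fun=> 1); split=> [//|a].
  by rewrite big_ord1 mulr1.
exists 2%N, (fun i => if i == ord0 then @complex.Re R else @complex.Im R).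
exists (fun i => if i == ord0 then 1 else 'i%C); split=> [i|a].
  by case: ifP => _ a [x1 x2] [y1 y2]; rewrite /= /GRing.scale /= ; simpc.
by rewrite big_ord_recl big_ord1 /= mulr1 mulrC -complexE.
Qed.

Section VectorValued.
Variables (R : realType) (k : ground) (W : normedModType R) (y : W).
Local Notation K := (scalar R k).

(* Smoothness for the underlying real structure, tested on real linear forms so
   that it makes no reference to coordinates of [X]. *)
Definition vsmooth_at (X : lmodType K) (u : W -> X) : Prop :=
  forall l : X -> R, real_form l -> smooth_at (l \o u) y.

Lemma vsmooth_at_cst (X : lmodType K) (a : X) : vsmooth_at (fun=> a).
Proof. by move=> l _; exact: smooth_at_cst. Qed.

Lemma vsmooth_at_lin (X Y : lmodType K) (h : X -> Y) (u : W -> X) :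
  linear h -> vsmooth_at u -> vsmooth_at (h \o u).
Proof. by move=> hl su l ll; apply: (su (l \o h)); exact: real_form_comp. Qed.

Lemma vsmooth_at_sum (X : lmodType K) (I : Type) (s : seq I) (u : I -> W -> X) :
  (forall i, vsmooth_at (u i)) -> vsmooth_at (fun z => \sum_(i <- s) u i z).
Proof.
move=> su l ll.
have -> : l \o (fun z => \sum_(i <- s) u i z) = fun z => \sum_(i <- s) l (u i z).
  apply/funext => z /=; elim: s => [|i s IH];
    first by rewrite !big_nil real_form0.
  by rewrite !big_cons real_formD// IH.
by apply: smooth_at_sum => i; exact: su.
Qed.

(** A real form is not linear over the ground field, so [a z] cannot be pulled out of [l]. Its real
    components can, and what remains of the scalar, the constant [b i], is absorbed into the real
    form [l \o *:%R (b i)]. *)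
Lemma vsmooth_atZ (X : lmodType K) (a : W -> K^o) (u : W -> X) :
  vsmooth_at a -> vsmooth_at u -> vsmooth_at (fun z => a z *: u z).
Proof.
move=> sa su l ll; have [s [m [b [ml mE]]]] := real_form_scale R k.
have -> : l \o (fun z => a z *: u z) = fun z => \sum_i m i (a z) * l (b i *: u z).
  apply/funext => z /=; rewrite [in LHS](mE (a z)) scaler_suml.
  rewrite (big_morph l (fun x x' => real_formD x x' ll) (real_form0 ll)).
  by apply: eq_bigr => i _; rewrite -scalerA real_formZ.
apply: smooth_at_sum => i; apply: smooth_atM; first exact: sa (ml i).
apply: (su (l \o *:%R (b i))); apply: real_form_comp ll => c x x'.
by rewrite scalerDr !scalerA mulrC.
Qed.

(** The forms assemble into an injective linear map to a coordinate space. A linear left inverse of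
    it writes [u] as a combination of constant vectors with smooth coefficients. No basis of [Y] is
    needed: for tensors and linear maps, evaluations on basis vectors serve as the forms. *)
Lemma vsmooth_at_separating (Y : vectType K) (I : finType)
    (l : I -> {linear Y -> K^o}) (u : W -> Y) :
  (forall v, (forall i, l i v = 0) -> v = 0) ->
  (forall i, vsmooth_at (l i \o u)) -> vsmooth_at u.
Proof.
move=> l_sep su; pose phi (v : Y) : {ffun I -> K^o} := [ffun i => l i v].
have phil : linear phi by move=> a v w; apply/ffunP => i;
  rewrite !ffunE linearP.
pose Phi : 'Hom(Y, {ffun I -> K^o}) :=
  linfun (HB.pack phi (GRing.isLinear.Build _ _ _ _ phi phil) : {linear _ -> _}).
have PhiE v : Phi v = phi v by rewrite lfunE.
have PhiK : cancel Phi (Phi^-1)%VF.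
  apply/lker0_lfunK/eqP/vspaceP => v; rewrite memv_ker memv0 PhiE.
  apply/eqP/eqP => [phi0|->]; last by apply/ffunP => i; rewrite !ffunE linear0.
  by apply: l_sep => i; have := congr1 (fun g : {ffun I -> K^o} => g i) phi0;
    rewrite !ffunE.
have -> : u = fun z => \sum_i l i (u z) *: (Phi^-1)%VF [ffun j => (j == i)%:R].
  apply/funext => z; rewrite -[LHS]PhiK.
  under eq_bigr do rewrite -linearZ; rewrite -linear_sum; congr (_ _).
  apply/ffunP => j; rewrite PhiE ffunE sum_ffunE (bigD1 j)//= big1 => [|i ij].
    by rewrite addr0 !ffunE eqxx [RHS]mulr1.
  by rewrite !ffunE eq_sym (negbTE ij) [LHS]mulr0.
by apply: vsmooth_at_sum => i; apply: vsmooth_atZ;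
  [exact: su|exact: vsmooth_at_cst].
Qed.

(** [G] may itself vary with the point, so that the vector and covector arguments of a tensor can be
    handled one group after the other. *)
Lemma vsmooth_at_multilinear n (X : vectType K) (Y : lmodType K)
    (G : W -> ('I_n -> X) -> Y) (u : 'I_n -> W -> X) :
  (forall z, multilinear (G z)) ->
  (forall h : 'I_n -> 'I_(\dim {:X}),
     vsmooth_at (fun z => G z (fun i => (vbasis {:X})`_(h i)))) ->
  (forall i, vsmooth_at (u i)) -> vsmooth_at (fun z => G z (u ^~ z)).
Proof.
move=> G_lin sG.
(* Invariant: the arguments of index at least [m] are already constant basis vectors. The induction
   step expands argument number [m] in the basis. *)
suff sGm m (v : 'I_n -> W -> X) : (forall i : 'I_n, (m <= i)%N ->
    exists j : 'I_(\dim {:X}), v i = fun=> (vbasis {:X})`_j) ->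
    (forall i, vsmooth_at (v i)) -> vsmooth_at (fun z => G z (v ^~ z)).
  by apply: (sGm n) => i; rewrite leqNgt ltn_ord.
elim: m v => [|m IH] v vb sv.
  have /choice[h hE] := fun i => vb i isT.
  rewrite (_ : (fun z => _) = fun z => G z (fun i => (vbasis {:X})`_(h i)))//.
  by apply/funext => z; congr (G z _); apply/funext => i; rewrite hE.
have [nm|mn] := leqP n m.
  by apply: IH => // i mi; have := leq_ltn_trans (leq_trans nm mi) (ltn_ord i);
    rewrite ltnn.
pose i0 := Ordinal mn.
pose w (x : X) := @dfwith _ (fun=> W -> X) v i0 (fun=> x).
pose upd z x := @dfwith _ (fun=> X) (v ^~ z) i0 x.
have wE x z : w x ^~ z = upd z x.
  apply/funext => i; rewrite /w /upd; have [<-|ii] := eqVneq i0 i.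
    by rewrite !dfwithin.
  by rewrite !dfwithout.
have -> : (fun z => G z (v ^~ z)) = fun z => \sum_j
    (coord (vbasis {:X}) j (v i0 z) : K^o) *: G z (w (vbasis {:X})`_j ^~ z).
  apply/funext => z; have Gl : linear (G z \o upd z) by move=> a x x';
    exact: G_lin.
  pose g : {linear X -> Y} := HB.pack (G z \o upd z) (GRing.isLinear.Build _ _ _ _ _ Gl).
  have -> : v ^~ z = upd z (v i0 z).
    by apply/funext => i; rewrite /upd; case: dfwithP.
  rewrite -[LHS]/(g (v i0 z)) [in LHS](coord_vbasis (memvf (v i0 z))) linear_sum.
  by apply: eq_bigr => j _; rewrite linearZ /= wE.
apply: vsmooth_at_sum => j; apply: vsmooth_atZ.
  by apply: vsmooth_at_lin (sv i0); exact: linearP.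
apply: IH => [i mi|i]; rewrite /w.
  case: dfwithP mi => [_|l il ml]; first by exists j.
  by apply: vb; rewrite ltn_neqAle ml andbT; apply: contra il => /eqP ?;
    exact/eqP/val_inj.
case: dfwithP => [|l _]; [exact: vsmooth_at_cst|exact: sv].
Qed.

End VectorValued.

(** * Charts of fibrations *)

Section RealCoordinates.
Variables (R : realType) (k : ground).

Lemma real_coordinates_exist (X : vectType (scalar R k)) :
  exists f : X -> 'rV[R]_(real_dim X), real_coordinates f.
Proof.
rewrite /real_coordinates /real_dim; have [g gl gb] := vector_axiomP X.
(* The dimension is left free up to a proof of equality, because [real_dim X] is a product and is
   not convertible to the [dim X] or [dim X + dim X] obtained in the two cases. *)
suff [n [e [f [fl fb]]]] : exists n, exists e : n = (real_degree k * dim X)%N,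
    exists f : X -> 'rV[R]_n, real_linear f /\ bijective f.
  by case: _ / e; exists f.
case: k X g gl gb => X g gl gb.
  by exists (dim X), (esym (mul1n _)), g; split=> // a x y; rewrite gl.
exists (dim X + dim X)%N, (etrans (addnn _) (esym (mul2n _))).
pose re := map_mx (@complex.Re R); pose im := map_mx (@complex.Im R).
exists (fun x => row_mx (re _ _ (g x)) (im _ _ (g x))); split=> [a x y|].
  rewrite gl scale_row_mx add_row_mx.
  by congr row_mx; apply/rowP => i; rewrite !mxE;
    case: (g x 0 i) (g y 0 i) => ? ? [? ?] /=;
    simpc.
have [h gK hK] := gb.
pose co (v : 'rV[R]_(dim X + dim X)) : 'rV[R[i]]_(dim X) :=
  \row_i (lsubmx v 0 i +i* rsubmx v 0 i)%C.
exists (h \o co) => [x|v] /=.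
  rewrite -[RHS]gK; congr (h _); apply/rowP => i.
  by rewrite mxE row_mxKl row_mxKr !mxE; case: (g x 0 i).
rewrite hK -[RHS]hsubmxK; congr row_mx; apply/rowP => i; rewrite !mxE//.
Qed.

Lemma real_form_coordinates (X : vectType (scalar R k)) n (f : X -> 'rV[R]_n) j :
  real_linear f -> real_form (fun x => f x 0 j).
Proof. by move=> fl a x y; rewrite fl !mxE. Qed.

Lemma inv_real_linear (X : vectType (scalar R k)) n (f : X -> 'rV[R]_n) g :
  real_linear f -> cancel f g -> cancel g f ->
  forall a u v, g (a *: u + v) = of_real k a *: g u + g v.
Proof. by move=> fl fK gK a u v; rewrite -[LHS]fK; apply: (can_inj fK);
  rewrite fl !gK. Qed.

End RealCoordinates.

Section BundleCharts.
Variables (R : realType) (B : Type) (m : nat).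
Implicit Types (c : chart R B m).

Lemma smooth_at_row_mx (V : normedModType R) n p (f : V -> 'rV[R]_n)
    (g : V -> 'rV[R]_p) x :
  smooth_at f x -> smooth_at g x -> smooth_at (fun y => row_mx (f y) (g y)) x.
Proof.
move=> sf sg; apply: smooth_at_rV => j; rewrite -(fintype.splitK j);
  case: (fintype.split j) => i /=.
  rewrite (_ : (fun y => _) = fun y => f y 0 i); first exact: smooth_at_coord.
  by apply/funext => y; rewrite row_mxEl.
rewrite (_ : (fun y => _) = fun y => g y 0 i); first exact: smooth_at_coord.
by apply/funext => y; rewrite row_mxEr.
Qed.

Lemma lsubmx_linear p q : linear (lsubmx : 'rV[R]_(p + q) -> 'rV[R]_p).
Proof. exact: linearP. Qed.

Lemma rsubmx_linear p q : linear (rsubmx : 'rV[R]_(p + q) -> 'rV[R]_q).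
Proof. exact: linearP. Qed.

Lemma near_lsubmx p q (u : 'rV[R]_p) (v : 'rV[R]_q) (P : set 'rV[R]_p) :
  nbhs u P -> nbhs (row_mx u v) (lsubmx @^-1` P).
Proof.
move=> uP; have := smooth_at_continuous (smooth_at_lin (row_mx u v) (@lsubmx_linear p q)).
by apply; rewrite row_mxKl.
Qed.

(* Covers both [prod_chart] and [Xi_chart], see [prod_chartE], [Xi_chartE];
   [phi] gives coordinates on the fibers of [pr]. *)
Definition bundle_chart (T : Type) n c (pr : T -> B) (phi : T -> 'rV[R]_n) :
    chart R T (m + n) :=
  Chart (pr @^-1` chart_dom c) (fun z => row_mx (chart_map c (pr z)) (phi z)).

Lemma near_bundle_chart (T : Type) n c (pr : T -> B) (phi : T -> 'rV[R]_n) z P :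
  near_chart c (pr z) P -> near_chart (bundle_chart c pr phi) z (pr @^-1` P).
Proof.
rewrite /near_chart /= => /near_lsubmx - /(_ _ (phi z)).
by apply: filterS => u uP w cw wu; apply: uP cw _; rewrite -wu row_mxKl.
Qed.

Lemma bundle_chart_is_chart (T : Type) n c (pr : T -> B) (phi : T -> 'rV[R]_n) :
  is_chart c ->
  (forall z w, chart_dom c (pr z) -> pr z = pr w -> phi z = phi w -> z = w) ->
  (forall q v, chart_dom c q -> exists2 z, pr z = q & phi z = v) ->
  is_chart (bundle_chart c pr phi).
Proof.
move=> [c_inj c_open] phi_inj phi_surj; split.
  move=> z w /[!inE] /= cz cw /eq_row_mx[zw]; apply: phi_inj => //.
  by apply: c_inj zw; rewrite inE.
rewrite openE => _ [z /= cz <-].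
have : nbhs (chart_map c (pr z)) (chart_image c).
  by apply: open_nbhs_nbhs; split=> //; exists (pr z).
move/near_lsubmx => /(_ _ (phi z)); apply: filterS => u [q cq qu].
have [w wq wu] := phi_surj q (rsubmx u) cq.
by exists w; rewrite /= ?wq// wu qu hsubmxK.
Qed.

(** [f] covers the identity of the base and is linear in the fiber coordinates, with columns [h j].
    The fiber coordinates of [f w] are then sums of products of a fiber coordinate and a function
    smooth on the base, hence smooth jointly. This serves transitions of product charts, transitions
    of the [Xi_chart], and [Delta] in both directions. *)
Lemma smooth_in_bundle_charts (T T' : Type) n n' c c'
    (pr : T -> B) (pr' : T' -> B) (phi : T -> 'rV[R]_n) (phi' : T' -> 'rV[R]_n')
    (f : T -> T') (h : 'I_n -> 'rV[R]_m -> 'rV[R]_n') z :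
  (forall w, pr' (f w) = pr w) -> chart_dom c (pr z) ->
  smooth_in_charts c c' id (pr z) ->
  (forall j, smooth_at (h j) (chart_map c (pr z))) ->
  near_chart c (pr z) [set q | forall w, pr w = q ->
    phi' (f w) = \sum_j phi w 0 j *: h j (chart_map c q)] ->
  smooth_in_charts (bundle_chart c pr phi) (bundle_chart c' pr' phi') f z.
Proof.
move=> prf cz [F sF nF] sh nh.
exists (fun u => row_mx (F (lsubmx u)) (\sum_j rsubmx u 0 j *: h j (lsubmx u))).
  have sl : smooth_at lsubmx (row_mx (chart_map c (pr z)) (phi z)).
    exact/smooth_at_lin/lsubmx_linear.
  apply: smooth_at_row_mx.
    by apply: (smooth_at_comp sl); rewrite row_mxKl.
  apply: smooth_at_sum => j; apply: smooth_at_rV => i.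
  rewrite (_ : (fun y => _) = fun y => rsubmx y 0 j * h j (lsubmx y) 0 i);
    last first.
    by apply/funext => y; rewrite mxE.
  apply: smooth_atM.
    exact/smooth_at_coord/smooth_at_lin/rsubmx_linear.
  by apply/smooth_at_coord/(smooth_at_comp sl); rewrite row_mxKl; exact: sh.
have := near_bundle_chart phi ([elaborate filterI nF nh]).
apply: filterS => w [[c'w Fw] /(_ w erefl) hw] /=; rewrite prf; split=> //.
by rewrite row_mxKl row_mxKr Fw hw.
Qed.

Lemma smooth_in_bundle_chart_proj (T : Type) n c c' (pr : T -> B)
    (phi : T -> 'rV[R]_n) z : smooth_in_charts c c' id (pr z) ->
  smooth_in_charts (bundle_chart c pr phi) c' pr z.
Proof.
move=> [F sF nF]; exists (F \o lsubmx).
  apply: smooth_at_comp; first exact/smooth_at_lin/lsubmx_linear.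
  by rewrite row_mxKl.
by apply: filterS (near_bundle_chart phi nF) => w /= [cw <-]; rewrite row_mxKl.
Qed.

End BundleCharts.

Section ProductSpace.
Variables (R : realType) (k : ground) (X : vectType (scalar R k)) (B : charted R).

Lemma prod_chartE (c : chart R B (mdim B)) (f : X -> 'rV[R]_(real_dim X)) :
  prod_chart c f = bundle_chart c fst (f \o snd).
Proof. by congr Chart; apply/funext => z; rewrite /= propeqE;
  split=> [[]|]. Qed.

Lemma prod_space_atlas : is_atlas (atlas B) ->
  is_maximal_atlas (atlas (prod_space X B)) /\
  forall c f, atlas B c -> real_coordinates f -> atlas (prod_space X B) (prod_chart c f).
Proof.
move=> AB; have [Bchart Bcov _] := AB.
suff /generated_atlasP[gM sg] : is_atlas [set e | exists2 c, atlas B c &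
    exists2 f : X -> 'rV[R]_(real_dim X), real_coordinates f & e = prod_chart c f].
  by split=> // c f Bc fP; apply: sg; exists c => //; exists f.
have ch c (f : X -> 'rV[R]_(real_dim X)) : atlas B c -> real_coordinates f ->
    is_chart (prod_chart c f).
  move=> Bc [fl fb]; rewrite prod_chartE; apply: bundle_chart_is_chart.
  - exact: Bchart.
  - by move=> [p x] [q y] /= _ -> /(bij_inj fb) ->.
  - by move=> q v _; have [g _ gK] := fb; exists (q, g v) => //=; exact: gK.
have tr c (f : X -> 'rV[R]_(real_dim X)) c' (f' : X -> 'rV[R]_(real_dim X)) :
    atlas B c -> real_coordinates f -> atlas B c' -> real_coordinates f' ->
    smooth_transition (prod_chart c f) (prod_chart c' f').
  move=> Bc fP Bc' f'P; apply/smooth_transitionP => [|z]; first exact: ch.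
  rewrite !prod_chartE /= => cz c'z; have [[fl [g fK gK]] [f'l _]] := (fP, f'P).
  (* The columns are constant: they are those of the real-linear change of coordinates from [f] to
     [f']. *)
  apply: (smooth_in_bundle_charts (h := fun j => fun=> f' (g (delta_mx 0 j)))) => //.
  - exact: atlas_smooth_id AB Bc Bc' cz c'z.
  - by move=> j; exact: smooth_at_cst.
  - apply: filterE => q w _ /=; rewrite -{1}[w.2]fK {1}(row_sum_delta (f w.2)).
    have gl := inv_real_linear fl fK gK.
    have Gl : linear (f' \o g) by move=> a u v; rewrite /= gl f'l.
    pose G : {linear 'rV[R]_(real_dim X) -> 'rV[R]_(real_dim X)} :=
      HB.pack (f' \o g) (GRing.isLinear.Build _ _ _ _ _ Gl).
    rewrite -[LHS]/(G _) linear_sum.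
    by apply: eq_bigr => j _; rewrite linearZ.
split.
- by move=> _ [c Bc [f fP ->]]; exact: ch.
- move=> [p x]; have [c Bc cp] := Bcov p.
  by have [f fP] := real_coordinates_exist X; exists (prod_chart c f) => //;
    exists c => //; exists f.
- by move=> _ _ [c Bc [f fP ->]] [c' Bc' [f' f'P ->]]; split; exact: tr.
Qed.

End ProductSpace.

(** * Pullbacks of tensors *)

Section Pullbacks.
Variable K : fieldType.

Section Bijective.
Variables (W W1 : vectType K) (L : 'Hom(W, W1)).
Hypothesis L_bij : bijective L.

Lemma bij_lfunK : cancel L (L^-1)%VF.
Proof.
apply/lker0_lfunK/eqP/vspaceP => v; rewrite memv_ker memv0.
by apply/eqP/eqP => [Lv0|->]; [apply: (bij_inj L_bij);
  rewrite linear0|exact: linear0].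
Qed.

Lemma bij_lfunVK : cancel (L^-1)%VF L.
Proof. by move=> v; have [g gK Kg] := L_bij; rewrite -[v]Kg bij_lfunK. Qed.

Lemma bij_lfunV : bijective (L^-1)%VF.
Proof. by exists L; [exact: bij_lfunVK|exact: bij_lfunK]. Qed.

Lemma comp_lfunV_id : (L^-1 \o L)%VF = \1%VF.
Proof. by apply/lfunP => v; rewrite comp_lfunE bij_lfunK id_lfunE. Qed.

Lemma comp_lfun_Vid : (L \o L^-1)%VF = \1%VF.
Proof. by apply/lfunP => v; rewrite comp_lfunE bij_lfunVK id_lfunE. Qed.

End Bijective.

(** [L^-1] is a generalized inverse, defined for every linear map; this identifies it with a given
    two-sided inverse. *)
Lemma bij_lfun_unique (W W1 : vectType K) (L : 'Hom(W, W1)) (L' : 'Hom(W1, W)) :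
  cancel L L' -> cancel L' L -> (L^-1)%VF = L'.
Proof.
move=> LK L'K; have L_bij : bijective L by exists L'.
by apply/lfunP => v; rewrite -{1}[v]L'K bij_lfunK.
Qed.

Variables (r s : nat).

Lemma eq_tensor (W : vectType K) (f g : tensor r s W) :
  (forall v w, f v w = g v w) -> f = g.
Proof. by move=> fg; apply/val_inj/funext => v; apply/funext => w;
  exact: fg. Qed.

Lemma pullback_linear (W W1 : vectType K) (L : 'Hom(W, W1)) :
  linear (@pullback K r s W W1 L).
Proof. by move=> a f g; apply: eq_tensor. Qed.

Lemma pullback_comp (W W1 W2 : vectType K) (L : 'Hom(W, W1)) (L' : 'Hom(W1, W2))
    (f : tensor r s W2) : bijective L -> bijective L' ->
  pullback L (pullback L' f) = pullback (L' \o L)%VF f.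
Proof.
move=> bL bL'; apply: eq_tensor => v w; rewrite /= /pullback_fun /= /pullback_fun.
congr (tensor_val f _ _); apply/funext => i; first by rewrite comp_lfunE.
rewrite -comp_lfunA; congr (_ \o _)%VF; apply/esym/bij_lfun_unique => x;
  rewrite !comp_lfunE.
  by rewrite !bij_lfunK.
by rewrite !bij_lfunVK.
Qed.

Lemma pullback_id (W : vectType K) (f : tensor r s W) : pullback \1%VF f = f.
Proof.
apply: eq_tensor => v w; rewrite /= /pullback_fun; congr (tensor_val f _ _).
  by apply/funext => i; rewrite id_lfunE.
apply/funext => i; rewrite (bij_lfun_unique (L' := \1%VF)) ?comp_lfun1r// => x;
  by rewrite !id_lfunE.
Qed.

Lemma pullbackK (W W1 : vectType K) (L : 'Hom(W, W1)) : bijective L ->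
  cancel (@pullback K r s W W1 L) (pullback L^-1%VF).
Proof.
move=> bL f; rewrite pullback_comp ?comp_lfun_Vid ?pullback_id//.
exact: bij_lfunV.
Qed.

Lemma pullbackVK (W W1 : vectType K) (L : 'Hom(W, W1)) : bijective L ->
  cancel (pullback L^-1%VF) (@pullback K r s W W1 L).
Proof.
move=> bL f; rewrite pullback_comp ?comp_lfunV_id ?pullback_id//.
exact: bij_lfunV.
Qed.

End Pullbacks.

Section SmoothPullback.
Variables (R : realType) (k : ground) (V : normedModType R) (y : V).
Variables (r s : nat) (X : vectType (scalar R k)).
Local Notation K := (scalar R k).

(** Meant for [u] the inverse of a change of trivialization: the composites are then the covector
    arguments of a pulled back tensor. Evaluations on a basis of [X] separate covectors. *)
Lemma vsmooth_at_hom (Y : vectType K) (u : V -> 'Hom(X, Y)) :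
  (forall x, vsmooth_at y (fun z => u z x)) ->
  forall w : 'Hom(Y, K^o), vsmooth_at y (fun z => (w \o u z)%VF).
Proof.
move=> su w.
pose ev (j : 'I_(\dim {:X})) (g : 'Hom(X, K^o)) : K^o := g (vbasis {:X})`_j.
have ev_lin j : linear (ev j) by move=> a g h;
  rewrite /ev add_lfunE scale_lfunE.
pose Ev j : {linear 'Hom(X, K^o) -> K^o} :=
  HB.pack (ev j) (GRing.isLinear.Build _ _ _ _ _ (ev_lin j)).
apply: (vsmooth_at_separating (l := Ev)) => [g g0|j].
  apply/lfunP => x; rewrite [RHS]lfunE [in LHS](coord_vbasis (memvf x)) linear_sum.
  by apply: big1 => j _; rewrite linearZ /= [X in _ *: X](g0 j) scaler0.
rewrite (_ : _ \o _ = w \o (fun z => u z (vbasis {:X})`_j)).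
  by apply: vsmooth_at_lin (su _); exact: linearP.
by apply/funext => z; rewrite /= /ev comp_lfunE.
Qed.

(** A tensor is determined by its values on basis vectors and covectors. For the pullback such a
    value is [f] at arguments moved by [A z] and its inverse, and multilinearity is used for each of
    the two groups of arguments. *)
Lemma vsmooth_at_pullback (A : V -> 'End(X)) (f : tensor r s X) :
  (forall x, vsmooth_at y (fun z => A z x)) ->
  (forall x, vsmooth_at y (fun z => (A z)^-1%VF x)) ->
  vsmooth_at y (fun z => pullback (A z) f).
Proof.
move=> sA sAV; have /asboolP[f1 f2] := tensorP f.
pose I := ({ffun 'I_r -> 'I_(\dim {:X})} *
           {ffun 'I_s -> 'I_(\dim {:'Hom(X, K^o)})})%type.
pose bv (h : I) i := (vbasis {:X})`_(h.1 i).
pose bw (h : I) j := (vbasis {:'Hom(X, K^o)})`_(h.2 j).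
pose ev (h : I) (g : tensor r s X) : K^o := g (bv h) (bw h).
have ev_lin h : linear (ev h) by [].
pose Ev h : {linear tensor r s X -> K^o} :=
  HB.pack (ev h) (GRing.isLinear.Build _ _ _ _ _ (ev_lin h)).
apply: (vsmooth_at_separating (l := Ev)) => [g g0|h].
  apply: eq_tensor => v w; have /asboolP[g1 g2] := tensorP g.
  apply: multilinear_eq0 (g2 v) _ w => hw.
  apply: multilinear_eq0 (g1 _) _ v => hv.
  rewrite -[RHS](g0 (finfun hv, finfun hw)) /= /ev /bv /bw /=.
  by congr (tensor_val g _ _); apply/funext => i; rewrite ffunE.
pose vv (i : 'I_r) z : X := A z (bv h i).
pose ww (j : 'I_s) z : 'Hom(X, K^o) := (bw h j \o (A z)^-1)%VF.
(* The moving covectors [ww] are first kept inside the multilinear map; once the vectors have become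
   constant basis vectors, the second application expands the covectors. *)
apply: (@vsmooth_at_multilinear _ _ _ _ _ _ _
  (fun z v => (f v (ww ^~ z)) : K^o) vv) => [z|hv|i]; last exact: sA.
  exact: f1.
apply: (@vsmooth_at_multilinear _ _ _ _ _ _ _ (fun z w => (f _ w) : K^o) ww) => [z|hw|j].
- exact: f2.
- exact: vsmooth_at_cst.
- exact: vsmooth_at_hom.
Qed.

End SmoothPullback.

(** * Changes of trivialization *)

Section BundleAtlases.
Variables (R : realType) (k : ground).
Variables (E B : charted R) (pi : E -> B) (X : vectType (scalar R k)).
Implicit Types (s t : triv E B X) (A G : set (triv E B X)).

Lemma triv_compatible_trans s t u p : triv_compatible pi s t ->
  triv_compatible pi t u -> triv_dom s p -> triv_dom t p -> triv_dom u p ->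
  exists2 L : 'End(X), bijective L &
    forall x, pi x = p -> L (triv_map u x).2 = (triv_map s x).2.
Proof.
move=> st tu sp tp up; have [L bL LE] := st _ sp tp; have [L' bL' LE'] :=
  tu _ tp up.
exists (L \o L')%VF => [|x xp].
  by apply: (eq_bij (bij_comp bL bL')) => x; rewrite /= comp_lfunE.
by rewrite comp_lfunE LE'// LE.
Qed.

(** Compatibility is a condition on single fibers, so over each [p] one member of [G] suffices as an
    intermediate. Smoothness is already part of [is_local_triv]. *)
Lemma generated_bundle_atlasP G : is_bundle_atlas pi G ->
  is_maximal_bundle_atlas pi (generated_bundle_atlas pi G) /\
  G `<=` generated_bundle_atlas pi G.
Proof.
move=> AG; have [GP Gcov Gcomp] := AG.
have sG : G `<=` generated_bundle_atlas pi G.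
  move=> t Gt; split=> [|s Gs]; first exact: GP.
  by split; exact: Gcomp.
split=> //; split; first split.
- by move=> t [].
- by move=> p; have [t /sG ? ?] := Gcov p; exists t.
- move=> s t [sP sG'] [tP tG'] p sp tp; have [u Gu up] := Gcov p.
  by apply: (triv_compatible_trans (sG' _ Gu).1 (tG' _ Gu).2 sp up tp).
- move=> A' [A'P _ A'comp] sA'; apply/seteqP; split=> // t A't.
  split=> [|s /sG/sA' A's]; first exact: A'P.
  by split; exact: A'comp.
Qed.

Lemma maximal_bundle_atlas_mem A t : is_maximal_bundle_atlas pi A ->
  is_local_triv pi t ->
  (forall s, A s -> triv_compatible pi t s /\ triv_compatible pi s t) -> A t.
Proof.
move=> [AP Amax] tP tA; have [[gA _] sA] := generated_bundle_atlasP AP.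
by rewrite -(Amax _ gA sA).
Qed.

Definition triv_restr (W : set B) t : triv E B X :=
  Triv (triv_dom t `&` W) (triv_map t).

End BundleAtlases.

Section ChartInverse.
Variables (R : realType) (B : Type) (m : nat).
Implicit Types c : chart R B m.

(** Total, with default [x0], so that functions of the base point become functions on the whole
    coordinate space; only germs at points of the open image are used. *)
Definition chart_inv (x0 : B) c (y : 'rV[R]_m) : B :=
  match pselect (exists2 x, chart_dom c x & chart_map c x = y) with
  | left e => s2val (cid2 e)
  | right _ => x0
  end.

Lemma chart_invK x0 c x : is_chart c -> chart_dom c x ->
  chart_inv x0 c (chart_map c x) = x.
Proof.
move=> [c_inj _] cx; rewrite /chart_inv; case: pselect => [e|[]];
  last by exists x.
by case: cid2 => z /= cz; apply: c_inj; rewrite inE.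
Qed.

Lemma near_chart_inv x0 c x (P : set B) : is_chart c -> chart_dom c x ->
  near_chart c x P -> \forall y \near chart_map c x,
    [/\ chart_dom c (chart_inv x0 c y), chart_map c (chart_inv x0 c y) = y
      & P (chart_inv x0 c y)].
Proof.
move=> cP cx; rewrite /near_chart /= => nP.
have : nbhs (chart_map c x) (chart_image c).
  by apply: open_nbhs_nbhs; split; [case: cP|exists x].
apply: filterS2 nP => y Py [z cz zy]; rewrite -zy chart_invK//.
by split=> //; exact: Py.
Qed.

End ChartInverse.

Section Bundle.
Variables (R : realType) (k : ground) (V : vector_bundle R k).
Local Notation B := (base V).
Local Notation X := (typical V).
Local Notation trivV := (triv (total V) B X).
Implicit Types (t : trivV) (c : chart R B (mdim B)) (p : B).

Let total_manifold : is_manifold (total V). Proof. by case: (bundleP V). Qed.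
Let base_manifold : is_manifold B. Proof. by case: (bundleP V). Qed.
Let total_max : is_maximal_atlas (atlas (total V)).
Proof. by case: total_manifold. Qed.
Let total_atlas : is_atlas (atlas (total V)). Proof. by case: total_max. Qed.
Lemma base_max : is_maximal_atlas (atlas B). Proof. by case: base_manifold. Qed.
Lemma base_atlas : is_atlas (atlas B). Proof. by case: base_max. Qed.
Let proj_smooth : smooth_on setT (proj V). Proof. by case: (bundleP V). Qed.
Let triv_max : is_maximal_bundle_atlas (proj V) (trivs V).
Proof. by case: (bundleP V). Qed.
Lemma trivs_atlas : is_bundle_atlas (proj V) (trivs V).
Proof. by case: triv_max. Qed.
Let prod_max := (prod_space_atlas X base_atlas).1.
Let prod_atlas := prod_max.1.

Lemma base_chart p : exists2 c, atlas B c & chart_dom c p.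
Proof. by have [_ /(_ p)] := base_atlas. Qed.

Lemma base_is_chart c : atlas B c -> is_chart c.
Proof. by have [H _ _] := base_atlas; exact: H. Qed.

Lemma triv_open t : trivs V t -> open (triv_dom t).
Proof. by have [H _ _] := trivs_atlas; move=> /H[]. Qed.

Lemma open_setX_setT (Y : vectType (scalar R k)) (W : set B) : open W ->
  open (W `*` setT : set (prod_space Y B)).
Proof.
move=> oW; rewrite openE => -[p y] [/= Wp _].
have [c Bc cp] := base_chart p; have [f fP] := real_coordinates_exist Y.
have [[pmax _] pG] := prod_space_atlas Y base_atlas.
have cpy : chart_dom (prod_chart c f) (p, y) by [].
rewrite /interior (nbhs_chart pmax (pG _ _ Bc fP) cpy) prod_chartE.
have : near_chart c p W by rewrite -(nbhs_chart base_atlas Bc cp);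
  exact: open_nbhs_nbhs.
move=> /(@near_bundle_chart _ _ _ _ _ c fst (f \o snd) (p, y)).
by apply: filterS => -[q z].
Qed.

Lemma triv_restr_mem (W : set B) t : trivs V t -> open W ->
  (triv_dom t `&` W) !=set0 -> trivs V (triv_restr W t).
Proof.
move=> Vt oW tW; have [VP _ Vcomp] := trivs_atlas.
apply: (maximal_bundle_atlas_mem triv_max) => [|s Vs].
  have [_ ot t1 [g [[tD gD] gK tK st sg]]] := VP _ Vt.
  have oI : open (triv_dom t `&` W) by exact: openI.
  split=> //=; first by move=> x [? _]; exact: t1.
  exists g; split.
  - split=> [x [tx Wx]|[p v] [[tp Wp] _]]; first by split=> //; rewrite /= t1.
    have h : (triv_dom t `*` setT) (p, v) by [].
    have E : proj V (g (p, v)) = p by rewrite -t1 ?tK//; exact: gD.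
    by rewrite /= E.
  - by move=> x [tx _]; exact: gK.
  - by move=> z [[tz _] _]; exact: tK.
  - apply: sub_smooth_on st => //; last by move=> x [].
    have := smooth_on_open_preimage total_atlas base_atlas proj_smooth oI.
    by rewrite setTI.
  - apply: sub_smooth_on sg => //; first exact: open_setX_setT.
    by move=> z [[]].
split=> p.
  by move=> [tp _] sp; exact: Vcomp Vt Vs _ tp sp.
by move=> sp [tp _]; exact: Vcomp Vs Vt _ sp tp.
Qed.

(** A generator of the tensor atlas needs a chart and a trivialization with the same domain. The
    chart is cut down to the domain of [t], then [t] to that of the chart; the two maximal atlases
    of [V] contain the results. *)
Lemma adapted_chart t p (W : set B) : trivs V t -> triv_dom t p -> open W -> W p ->
  exists c, [/\ atlas B c, trivs V (triv_restr (chart_dom c) t),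
    triv_dom (triv_restr (chart_dom c) t) = chart_dom c, chart_dom c p
    & chart_dom c `<=` triv_dom t `&` W].
Proof.
move=> Vt tp oW Wp; have [c Bc cp] := base_chart p.
have oI : open (triv_dom t `&` W) by apply: openI => //; exact: triv_open.
exists (chart_restr (triv_dom t `&` W) c).
have Br : atlas B (chart_restr (triv_dom t `&` W) c).
  apply: chart_restr_mem => // [|x cx Wx]; first exact: base_max.
  by rewrite -(nbhs_chart base_atlas Bc cx); exact: open_nbhs_nbhs.
split=> //=.
- by apply: triv_restr_mem => //; [exact: open_chart_dom Br|exists p].
- by rewrite setICA; congr (_ `&` _); rewrite setIA setIid.
Qed.

Lemma fiber_isoE t p : trivs V t -> triv_dom t p ->
  fiber_iso p t =1 fiber_coord t.
Proof.
move=> Vt tp; have fl := fiber_coord_linear Vt tp.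
pose F : {linear fib p -> X} :=
  HB.pack (@fiber_coord _ _ _ p t) (GRing.isLinear.Build _ _ _ _ _ fl).
exact: (lfunE F).
Qed.

Lemma fiber_iso_bij t p : trivs V t -> triv_dom t p -> bijective (fiber_iso p t).
Proof.
move=> Vt tp; apply: eq_bij (fiber_coord_bij Vt tp) _ _ => x.
by rewrite fiber_isoE.
Qed.

Definition triv_change t t' p : 'End(X) := (fiber_iso p t' \o (fiber_iso p t)^-1)%VF.

Lemma triv_change_bij t t' p : trivs V t -> trivs V t' -> triv_dom t p ->
  triv_dom t' p -> bijective (triv_change t t' p).
Proof.
move=> Vt Vt' tp t'p.
apply: eq_bij (bij_comp (fiber_iso_bij Vt' t'p) (bij_lfunV (fiber_iso_bij Vt tp))) _ _.
by move=> x; rewrite /= comp_lfunE.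
Qed.

Lemma triv_changeV t t' p : trivs V t -> trivs V t' -> triv_dom t p ->
  triv_dom t' p -> (triv_change t t' p)^-1%VF = triv_change t' t p.
Proof.
move=> Vt Vt' tp t'p.
have [b b'] := (fiber_iso_bij Vt tp, fiber_iso_bij Vt' t'p).
by apply: bij_lfun_unique => x; rewrite !comp_lfunE !(bij_lfunK, bij_lfunVK).
Qed.

Lemma smooth_triv_change t t' c p x : trivs V t -> trivs V t' -> triv_dom t p ->
  triv_dom t' p -> atlas B c -> chart_dom c p ->
  vsmooth_at (chart_map c p) (fun y => triv_change t t' (chart_inv p c y) x).
Proof.
move=> Vt Vt' tp t'p Bc cp; have [VP _ _] := trivs_atlas.
have [_ ot t1 [g [[tD gD] gK tK st sg]]] := VP _ Vt.
have [_ ot' t'1 [_ [_ _ _ st' _]]] := VP _ Vt'.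
have [f fP] := real_coordinates_exist X; have [fl [fi fK fiK]] := fP.
have Bcf : atlas (prod_space X B) (prod_chart c f) by apply: (prod_space_atlas
  X base_atlas).2.
have gp q v : triv_dom t q -> proj V (g (q, v)) = q.
  move=> tq; have h : (triv_dom t `*` setT) (q, v) by [].
  by rewrite -t1 ?tK//; exact: gD.
have changeE q v : triv_dom t q -> triv_dom t' q ->
    triv_map t' (g (q, v)) = (q, triv_change t t' q v).
  move=> tq t'q; rewrite [LHS]surjective_pairing t'1 ?gp//; congr (_, _).
  have -> : v = fiber_iso q t (exist _ (g (q, v)) (gp q v tq)).
    by rewrite fiber_isoE// /fiber_coord /= tK.
  rewrite comp_lfunE bij_lfunK; last exact: fiber_iso_bij.
  by rewrite fiber_isoE// fiber_isoE// /fiber_coord /= tK.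
have [e Ve egp] : exists2 e, atlas (total V) e & chart_dom e (g (p, x)).
  by have [_ /(_ (g (p, x)))] := total_atlas.
have cpx : chart_dom (prod_chart c f) (p, x) by [].
have [F sF nF] : smooth_in_charts (prod_chart c f) (prod_chart c f)
    (triv_map t' \o g) (p, x).
  apply: (smooth_in_charts_comp cpx (d := e)).
    exact: smooth_onW prod_atlas total_atlas sg _ Bcf Ve cpx egp.
  apply: smooth_onW total_atlas prod_atlas st' _ Ve Bcf egp _.
    by rewrite /= gp.
  by rewrite changeE.
move=> l ll.
(* [F] represents [t' \o g] in product coordinates. Freezing the fiber coordinate at [f x],
   discarding the base coordinates and undoing [f] leaves the change of trivialization at [x]. *)
pose G y := l (fi (rsubmx (F (row_mx y (f x))))).
have srow : smooth_at (fun y => row_mx y (f x)) (chart_map c p).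
  by apply: smooth_at_row_mx; [exact: smooth_at_lin|exact: smooth_at_cst].
have sG : smooth_at G (chart_map c p).
  have lfi_lin : linear (l \o fi : 'rV[R]_(real_dim X) -> R).
    by move=> a u v; rewrite /= (inv_real_linear fl fK fiK) ll.
  apply: (@smooth_at_comp_scalar _ _ _ _ (l \o fi)); last exact: smooth_at_lin.
  apply: (smooth_at_comp (f := fun y => F (row_mx y (f x)))); last first.
    exact/smooth_at_lin/rsubmx_linear.
  exact: smooth_at_comp srow sF.
apply: near_eq_smooth_at sG.
have nt : near_chart c p (triv_dom t `&` triv_dom t').
  by rewrite -(nbhs_chart base_atlas Bc cp); apply: open_nbhs_nbhs; split=> //;
    exact: openI.
have nF' := smooth_at_continuous srow nF.
apply: (@filterS2 _ (nbhs (chart_map c p)) _ _ _ _ _ nF'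
  (near_chart_inv p (base_is_chart Bc) cp nt)) => y yF [cy yE [ty t'y]].
set q := chart_inv p c y in cy yE ty t'y *.
have cqx : chart_dom (prod_chart c f) (q, x) by [].
have := yF (q, x) cqx; rewrite /= yE => /(_ erefl) [_].
by rewrite /G => ->; rewrite changeE//= row_mxKr fK.
Qed.

End Bundle.

(** * Countable bases *)

Section SecondCountable.
Variable R : realType.

Lemma second_countable_rV n : @second_countable 'rV[R]_n.
Proof.
pose b (qe : 'rV[rat]_n * rat) : set 'rV[R]_n :=
  interior (ball (map_mx (ratr : rat -> R) qe.1) (ratr qe.2 : R)).
exists (range b).
  by apply: (sub_countable (card_image_le _ _)); exact: countableP.
split; first by move=> _ [qe _ <-]; exact: open_interior.
move=> u P /nbhs_ballP[e /= e0 eP].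
(* With [e' < e / 2] and a rational center within [e' / 2] of [u], the ball of radius [e'] contains
   the ball of radius [e' / 2] around [u], and stays within [3 * e' / 2 < e] of [u]. *)
have [e'] := rat_in_itvoo (divr_gt0 e0 (ltr0n R 2)).
rewrite in_itv /= => /andP[e'0 e'e].
have q_ex (i : 'I_n) : exists q : rat, `|u 0 i - ratr q| < ratr e' / 2 :> R.
  have [|q] := rat_in_itvoo (_ : u 0 i - ratr e' / 2 < u 0 i + ratr e' / 2).
    by lra.
  by rewrite in_itv /= => /andP[uq qu]; exists q; rewrite ltr_norml; lra.
have [q qP] := choice q_ex; exists (b (\row_i q i, e')).
  split; first by exists (\row_i q i, e').
  apply/nbhs_ballP; exists (ratr e' / 2) => [|v [_ uv]]; first exact: divr_gt0.
  split=> // i j; rewrite (ord1 i) !mxE; have := uv 0 j; have := qP j.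
  rewrite /ball /= !ltr_norml; lra.
move=> v /interior_subset[_ qv]; apply: eP; split=> // i j; rewrite (ord1 i).
have := qv 0 j; have := qP j; rewrite !mxE /ball /= !ltr_norml; lra.
Qed.

Lemma second_countable_charted (M : charted R) (G : set (chart R M (mdim M))) :
  is_atlas (atlas M) -> countable G -> G `<=` atlas M ->
  (forall x, exists2 c, G c & chart_dom c x) -> @second_countable M.
Proof.
move=> AM cG GM Gcov; have [D cD [Do Db]] := second_countable_rV (mdim M).
pose b (cO : chart R M (mdim M) * set 'rV[R]_(mdim M)) : set M :=
  chart_dom cO.1 `&` chart_map cO.1 @^-1` cO.2.
exists (b @` (G `*` D)).
  by apply: (sub_countable (card_image_le _ _)); exact: countableX.
split; first by move=> _ [[c O] [/= /GM Mc /Do oO] <-];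
  exact: open_chart_preimage.
move=> x P xP; have [c Gc cx] := Gcov x.
rewrite (nbhs_chart AM (GM _ Gc) cx) in xP.
have [ O [DO Ox] OP] := Db (chart_map c x) _ xP.
exists (b (c, O)); first by split=> //; exists (c, O).
by move=> z [cz Oz]; exact: OP Oz z cz erefl.
Qed.

End SecondCountable.

(** * The manifold of tensors *)

Section TensorBundle.
Variables (R : realType) (k : ground) (V : vector_bundle R k) (r s : nat).
Local Notation B := (base V).
Local Notation X := (typical V).
Local Notation T := (tensor r s X).
Local Notation N := (real_dim T).
Local Notation tensorsV := (tensors V r s).
Local Notation pr := (@tensor_base R k V r s).
Local Notation trivV := (triv (total V) B X).
Implicit Types (t : trivV) (c : chart R B (mdim B)) (f : T -> 'rV[R]_N).

(** Pullback is contravariant: passing from the coordinates of [t] to those of [t'] uses the change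
    from [t'] to [t]. *)
Lemma tensor_coord_change t t' (z : tensorsV) : trivs V t -> trivs V t' ->
  triv_dom t (pr z) -> triv_dom t' (pr z) ->
  tensor_coord t' z = pullback (triv_change t' t (pr z)) (tensor_coord t z).
Proof.
move: z => [p a] Vt Vt' /= tp t'p; rewrite /tensor_coord /=.
have [b b'] := (fiber_iso_bij Vt tp, fiber_iso_bij Vt' t'p).
rewrite pullback_comp; [|exact: triv_change_bij|exact: bij_lfunV].
congr pullback; apply/lfunP => v.
by rewrite !comp_lfunE bij_lfunK.
Qed.

Definition tensor_of_coord t (z : B * T) : tensorsV :=
  existT _ z.1 (pullback (fiber_iso z.1 t) z.2).

Lemma tensor_coordK t (z : tensorsV) : trivs V t -> triv_dom t (pr z) ->
  tensor_of_coord t (pr z, tensor_coord t z) = z.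
Proof.
move: z => [p a] Vt /= tp; congr existT; rewrite /tensor_coord /=.
exact/pullbackVK/fiber_iso_bij.
Qed.

Lemma tensor_of_coordK t p (a : T) : trivs V t -> triv_dom t p ->
  tensor_coord t (tensor_of_coord t (p, a)) = a.
Proof. by move=> Vt tp; rewrite /tensor_coord /=;
  exact/pullbackK/fiber_iso_bij. Qed.

Lemma Xi_chartE c t f :
  Xi_chart c t f = bundle_chart c pr (f \o tensor_coord t).
Proof. by []. Qed.

Lemma Xi_is_chart c t f : atlas B c -> trivs V t -> chart_dom c `<=` triv_dom t ->
  real_coordinates f -> is_chart (Xi_chart c t f).
Proof.
move=> Bc Vt ct [fl fb]; rewrite Xi_chartE; apply: bundle_chart_is_chart.
- exact: base_is_chart.
- move=> z w cz zw /(bij_inj fb) fzw; have tz := ct _ cz.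
  by rewrite -(tensor_coordK Vt tz) fzw zw tensor_coordK// -zw.
- move=> q v cq; have [g _ gK] := fb.
  exists (tensor_of_coord t (q, g v)) => //=.
  by rewrite tensor_of_coordK ?gK//; exact: ct.
Qed.

Lemma Xi_smooth_transition c t f c' t' f' (z : tensorsV) :
  atlas B c -> trivs V t -> real_coordinates f ->
  atlas B c' -> trivs V t' -> real_coordinates f' ->
  chart_dom c (pr z) -> triv_dom t (pr z) ->
  chart_dom c' (pr z) -> triv_dom t' (pr z) ->
  smooth_in_charts (Xi_chart c t f) (Xi_chart c' t' f') id z.
Proof.
move=> Bc Vt fP Bc' Vt' f'P cz tz c'z t'z; rewrite !Xi_chartE.
have [[fl [g fK gK]] [f'l _]] := (fP, f'P).
pose A y := triv_change t' t (chart_inv (pr z) c y).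
(* The tensors [g (delta_mx 0 j)] form the real basis belonging to [f]; column [j] is the pullback
   of one of these fixed tensors, read in [f']. *)
pose h (j : 'I_N) y := f' (pullback (A y) (g (delta_mx 0 j))).
have nt : near_chart c (pr z) (triv_dom t `&` triv_dom t').
  rewrite -(nbhs_chart (base_atlas V) Bc cz); apply: open_nbhs_nbhs.
  by split=> //; apply: openI; exact: triv_open.
apply: (smooth_in_bundle_charts (h := h)) => //.
- exact: atlas_smooth_id (base_atlas V) Bc Bc' cz c'z.
- move=> j; apply: smooth_at_rV => i.
  have sA : vsmooth_at (chart_map c (pr z)) (fun y => pullback (A y) (g (delta_mx 0 j))).
    apply: vsmooth_at_pullback => x; first exact: smooth_triv_change.
    (* [triv_changeV] holds only over the common domain of [t] and [t'], so the inverse is replaced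
       by the opposite change near the point and not everywhere. *)
    move=> l ll; have := smooth_triv_change x Vt Vt' tz t'z Bc cz ll.
    apply: near_eq_smooth_at.
    have := near_chart_inv (pr z) (base_is_chart Bc) cz nt.
    by apply: filterS => y [_ _ [ty t'y]]; rewrite /A /= triv_changeV.
  exact: sA (real_form_coordinates i f'l).
- have nc := near_chart_dom c (pr z).
  apply: filterS2 nc nt => q cq [tq t'q] w wq /=.
  rewrite /h /A chart_invK//; last exact: base_is_chart.
  rewrite (tensor_coord_change Vt Vt') ?wq//.
  have Gl : linear (fun v => f' (pullback (triv_change t' t q) (g v))).
    by move=> a u v; rewrite /= (inv_real_linear fl fK gK) pullback_linear f'l.
  pose G : {linear 'rV[R]_N -> 'rV[R]_N} :=
    HB.pack (fun v => f' (pullback (triv_change t' t q) (g v)))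
      (GRing.isLinear.Build _ _ _ _ _ Gl).
  rewrite -{1}[tensor_coord t w]fK -[LHS]/(G _) [in LHS](row_sum_delta (f _)) linear_sum.
  by apply: eq_bigr => j _; rewrite linearZ.
Qed.

Lemma Xi_atlas : is_atlas (Xi_charts V r s).
Proof.
split.
- move=> _ [c [t [f [Bc Vt ct fP ->]]]].
  by apply: Xi_is_chart => //; rewrite ct.
- move=> z; have [_ /(_ (pr z))[t Vt tz] _] := trivs_atlas V.
  have [c [Bc Vr dr cz _]] := adapted_chart Vt tz openT I.
  have [f fP] := real_coordinates_exist T.
  by exists (Xi_chart c (triv_restr (chart_dom c) t) f) => //;
    exists c, (triv_restr (chart_dom c) t), f.
- have tr e e' : Xi_charts V r s e -> Xi_charts V r s e' -> smooth_transition e e'.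
    move=> [c [t [f [Bc Vt ct fP ->]]]] [c' [t' [f' [Bc' Vt' c't' f'P ->]]]].
    apply/smooth_transitionP => [|z /= cz c'z].
      by apply: Xi_is_chart => //; rewrite ct.
    by apply: Xi_smooth_transition => //; [rewrite -ct|rewrite -c't'].
  by move=> e e' He He'; split; exact: tr.
Qed.

Let M := tensor_manifold V r s.

Lemma tensor_atlas_max : is_maximal_atlas (atlas M).
Proof. exact: (generated_atlasP Xi_atlas).1. Qed.

Lemma Xi_charts_atlas : Xi_charts V r s `<=` atlas M.
Proof. exact: (generated_atlasP Xi_atlas).2. Qed.

Let M_atlas : is_atlas (atlas M) := tensor_atlas_max.1.

(** [t] itself, not its restriction, appears in the resulting chart: restricting keeps [triv_map],
    the only part of a trivialization that [Xi_chart] reads. *)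
Lemma adapted_Xi_chart t (z : tensorsV) (W : set B) : trivs V t ->
  triv_dom t (pr z) -> open W -> W (pr z) ->
  exists c f, [/\ atlas B c, real_coordinates f, chart_dom c (pr z),
    chart_dom c `<=` triv_dom t `&` W & Xi_charts V r s (Xi_chart c t f)].
Proof.
move=> Vt tz oW Wz; have [c [Bc Vr dr cz cW]] := adapted_chart Vt tz oW Wz.
have [f fP] := real_coordinates_exist T.
by exists c, f; split=> //; exists c, (triv_restr (chart_dom c) t), f.
Qed.

Lemma tensor_proj_smooth : smooth_on setT (@tensor_proj R k V r s).
Proof.
apply: smooth_onI; [exact: tensor_atlas_max|exact: openT|move=> z _].
have [_ /(_ (pr z))[t Vt tz] _] := trivs_atlas V.
have [c [f [Bc fP cz cW Xc]]] := adapted_Xi_chart Vt tz openT I.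
exists (Xi_chart c t f), c; split=> //; first exact: Xi_charts_atlas.
by rewrite Xi_chartE; apply: smooth_in_bundle_chart_proj;
  exact: smooth_in_charts_id.
Qed.

Lemma tensor_proj_open (W : set B) : open W -> open (@tensor_proj R k V r s @^-1` W).
Proof.
move=> oW.
have := smooth_on_open_preimage M_atlas (base_atlas V) tensor_proj_smooth oW.
by rewrite setTI.
Qed.

(** Inseparable points have inseparable projections, hence the same base point. The domain of a
    [Xi_chart] is a full preimage under the projection, so one chart contains both points, and they
    coincide by separation in the coordinate space. *)
Lemma tensor_hausdorff : hausdorff_space M.
Proof.
move=> z w zw.
have /eqP : pr z = pr w.
  have [_ _ hB _] : is_manifold B by case: (bundleP V).
  apply: hB => P Q /nbhs_open[P' [oP' P'z] P'P] /nbhs_open[Q' [oQ' Q'w] Q'Q].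
  have [x [P'x Q'x]] := zw (pr @^-1` P') (pr @^-1` Q')
    (open_nbhs_nbhs (conj (tensor_proj_open oP') P'z))
    (open_nbhs_nbhs (conj (tensor_proj_open oQ') Q'w)).
  by exists (pr x); split; [exact: P'P|exact: Q'Q].
move=> /eqP pzw.
have [_ /(_ (pr z))[t Vt tz] _] := trivs_atlas V.
have [c [f [Bc fP cz cW /Xi_charts_atlas Ae]]] :=
  adapted_Xi_chart Vt tz openT I.
have cw : chart_dom c (pr w) by rewrite -pzw.
set e := Xi_chart c t f in Ae.
have [/(_ _ Ae)[e_inj _] _ _] := M_atlas.
apply: e_inj; rewrite ?inE//.
have near_e (x : tensorsV) (P : set 'rV[R]_(mdim M)) : chart_dom c (pr x) ->
    nbhs (chart_map e x) P -> nbhs (x : M) (chart_map e @^-1` P).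
  move=> cx nP; rewrite (nbhs_chart M_atlas Ae cx) /near_chart /=.
  by apply: filterS nP => u Pu y _ yu; rewrite /preimage /= yu.
apply: (@norm_hausdorff _ 'rV[R]_(mdim M)) => P Q /(near_e _ _ cz) nP /(near_e _ _ cw) nQ.
by have [x [Px Qx]] := zw _ _ nP nQ; exists (chart_map e x).
Qed.

Lemma tensor_second_countable : @second_countable M.
Proof.
have [_ _ _ [D cD [Do Db]]] : is_manifold B by case: (bundleP V).
(* Each set [b] over which some generating chart is defined gets one such chart. For other [b],
   nothing is recorded about [e b]; intersecting with [atlas M] below makes this harmless. *)
have /choice[e eP] (b : set B) : exists e : chart R M (mdim M),
    (exists2 e', Xi_charts V r s e' & pr @^-1` b `<=` chart_dom e') ->
    Xi_charts V r s e /\ pr @^-1` b `<=` chart_dom e.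
  have [[e' Xe' be']|ne] := pselect (exists2 e', Xi_charts V r s e' &
      pr @^-1` b `<=` chart_dom e'); first by exists e'.
  by exists (Chart set0 (fun=> 0)).
apply: (@second_countable_charted _ M (atlas M `&` (e @` D))) => //.
- by apply: sub_countable (subset_card_le _) (sub_countable (card_image_le e D) cD) => x [].
- move=> z; have [_ /(_ (pr z))[t Vt tz] _] := trivs_atlas V.
  have [c [f [Bc fP cz cW Xc]]] := adapted_Xi_chart Vt tz openT I.
  have nc : nbhs (pr z) (chart_dom c).
    by apply: open_nbhs_nbhs; split=> //; exact: open_chart_dom.
  have [b [Db' bz] bc] := Db (pr z) _ nc.
  have [Xe be] : Xi_charts V r s (e b) /\ pr @^-1` b `<=` chart_dom (e b).
    by apply: eP; exists (Xi_chart c t f) => // x /bc.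
  by exists (e b); [split; [exact: Xi_charts_atlas|exists b]|exact: be].
Qed.

Lemma tensor_is_manifold : is_manifold M.
Proof.
have [B0 _ _ _] : is_manifold B by case: (bundleP V).
split; [by rewrite addn_gt0 B0|exact: tensor_atlas_max|exact: tensor_hausdorff|].
exact: tensor_second_countable.
Qed.

End TensorBundle.

(** * The bundle of tensors *)

Section DeltaAtlas.
Variables (R : realType) (k : ground) (V : vector_bundle R k) (r s : nat).
Local Notation B := (base V).
Local Notation X := (typical V).
Local Notation T := (tensor r s X).
Local Notation M := (tensor_manifold V r s).
Local Notation pr := (@tensor_proj R k V r s).
Implicit Types t : triv (total V) B X.

Lemma Delta_local_triv t : trivs V t -> is_local_triv pr (Delta r s t).
Proof.
move=> Vt; have [/(_ _ Vt)[t0 ot _ _] _ _] := trivs_atlas V.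
have [[pmax _] pG] := prod_space_atlas T (base_atlas V).
have smooth_delta c (j : 'I_(real_dim T)) p :
    smooth_at (fun=> delta_mx 0 j : 'rV[R]_(real_dim T)) (chart_map (c : chart
      R B (mdim B)) p).
  exact: smooth_at_cst.
split=> //; exists (tensor_of_coord t); split.
- by split=> [z tz|[p a] []].
- by move=> z tz; exact: tensor_coordK.
- by move=> [p a] [/= tp _]; congr pair; exact: tensor_of_coordK.
- apply: smooth_onI => [||z tz]; [exact: tensor_atlas_max|exact: tensor_proj_open|].
  have [c [f [Bc fP cz cW Xc]]] := adapted_Xi_chart Vt tz openT I.
  exists (Xi_chart c t f), (prod_chart c f).
  split=> //; [exact: Xi_charts_atlas|exact: pG|].
  rewrite Xi_chartE prod_chartE.
  apply: (smooth_in_bundle_charts (h := fun j => fun=> delta_mx 0 j)) => //.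
    exact: smooth_in_charts_id.
  by apply: filterE => q w _ /=; exact: row_sum_delta.
- have pM := (prod_space_atlas T (base_atlas V)).1.
  apply: smooth_onI => [||[p a] [/= tp _]]; [exact: pM|exact: open_setX_setT|].
  have tz : triv_dom t (tensor_base (tensor_of_coord t (p, a))) by [].
  have [c [f [Bc fP cz cW Xc]]] := adapted_Xi_chart Vt tz openT I.
  exists (prod_chart c f), (Xi_chart c t f).
  split=> //; [exact: pG|exact: Xi_charts_atlas|].
  rewrite Xi_chartE prod_chartE.
  apply: (smooth_in_bundle_charts (h := fun j => fun=> delta_mx 0 j)) => //.
    exact: smooth_in_charts_id.
  have nc := near_chart_dom c p.
  apply: filterS nc => q cq [q' b] /= qq; rewrite qq tensor_of_coordK//.
    exact: row_sum_delta.
  by have [] := cW _ cq.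
Qed.

(** The transition between the two trivializations over [p] is the pullback along the change from
    [t] to [t'], with inverse the pullback along the inverse map. *)
Lemma Delta_compatible t t' : trivs V t -> trivs V t' ->
  triv_compatible pr (Delta r s t) (Delta r s t').
Proof.
move=> Vt Vt' p /= tp t'p.
have cb := triv_change_bij Vt Vt' tp t'p.
pose L : {linear T -> T} := HB.pack (@pullback _ r s _ _ (triv_change t t' p))
  (GRing.isLinear.Build _ _ _ _ _ (@pullback_linear _ r s _ _ (triv_change t t' p))).
exists (linfun L) => [|z zp].
  apply: eq_bij (_ : bijective L) _ _ => [|x]; last by rewrite lfunE.
  by exists (pullback (triv_change t t' p)^-1%VF);
    [exact: pullbackK|exact: pullbackVK].
by rewrite lfunE /= (tensor_coord_change Vt' Vt) ?[tensor_base _]zp.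
Qed.

Lemma Delta_atlas : is_bundle_atlas pr (Delta r s @` trivs V).
Proof.
split.
- by move=> _ [t Vt <-]; exact: Delta_local_triv.
- move=> p; have [_ /(_ p)[t Vt tp] _] := trivs_atlas V.
  by exists (Delta r s t) => //; exists t.
- by move=> _ _ [t Vt <-] [t' Vt' <-]; exact: Delta_compatible.
Qed.

End DeltaAtlas.

(* The inclusions say that the two generated maximal atlases, defined as the
   sets of all charts (trivializations) compatible with the generators, do
   contain the generators. *)
Theorem corollary5p2 (R : realType) (k : ground) (V : vector_bundle R k)
    (r s : nat) :
  [/\ is_smooth_vector_bundle (tensor_bundle V r s),
      Xi_charts V r s `<=` atlas (tensor_manifold V r s)
    & forall t, trivs V t -> tensor_trivs V r s (Delta r s t)].
Proof.
have [Dmax DG] := generated_bundle_atlasP (Delta_atlas V r s).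
split; [split|exact: Xi_charts_atlas|by move=> t Vt; apply: DG; exists t].
- exact: tensor_is_manifold.
- by case: (bundleP V).
- exact: tensor_proj_smooth.
- exact: Dmax.
Qed.
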